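(* Consider the finite complete-information game with pure-strategy Nash equilibrium and ordered actions described in the context, with payoffs $$u_i^{(\gamma,\sigma)}(y,x,\lambda,\varepsilon_i)=V_i^{(\gamma,\sigma)}(y,x,\lambda)+y_i\varepsilon_i,\qquad V_i^{(\gamma,\sigma)}(y,x,\lambda)=v_i^\gamma(y,x)+y_iS_i(\sigma)\lambda,$$ where $v_i^\gamma(y,x)$ is affine in $\gamma$ for each $i,y,x$. Suppose that: (a) $\lambda,\varepsilon_1,\ldots,\varepsilon_I$ are mutually independent and independent of $x$, and $\lambda$ has a log-concave density $h$ not depending on $(\gamma,\sigma)$; (b) (strict concavity in own action) for each player $i$, opponents' profile $y_{-i}$, covariate value $x$, common shock $\lambda$, parameter value $(\gamma,\sigma)$, and each $\ell=1,\ldots,L_i-1$, $$\frac{V_i^{(\gamma,\sigma)}(s_i^{\ell+1},y_{-i},x,\lambda)-V_i^{(\gamma,\sigma)}(s_i^{\ell},y_{-i},x,\lambda)}{s_i^{\ell+1}-s_i^{\ell}}<\frac{V_i^{(\gamma,\sigma)}(s_i^{\ell},y_{-i},x,\lambda)-V_i^{(\gamma,\sigma)}(s_i^{\ell-1},y_{-i},x,\lambda)}{s_i^{\ell}-s_i^{\ell-1}};$$ (c) the scalar shocks $\varepsilon_1,\ldots,\varepsilon_I$ are independent of $(x,\lambda)$, mutually independent, and identically distributed standard logistic, with cumulative distribution function $F(t)=1/(1+\exp(-t))$. Then, for each player $i$, action profile $y\in\mathcal Y$, covariate value $x\in\mathcal X$, common shock $\lambda$, and parameter $(\gamma,\sigma)$,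 $$\mathcal M_i^{(\gamma,\sigma)}(y_i\mid y_{-i},x,\lambda)=F\big(e_i^{(\gamma,\sigma)}(y_i^+,y_{-i},x,\lambda)\big)-F\big(e_i^{(\gamma,\sigma)}(y_i,y_{-i},x,\lambda)\big).$$ Consequently, $$\mathcal L_{(\gamma,\sigma)}(y\mid x,\lambda)=\prod_{i=1}^I\Big[F\big(e_i^{(\gamma,\sigma)}(y_i^+,y_{-i},x,\lambda)\big)-F\big(e_i^{(\gamma,\sigma)}(y_i,y_{-i},x,\lambda)\big)\Big]$$ and $$\mathcal L_{(\gamma,\sigma)}(y\mid x)=\int\prod_{i=1}^I\Big[F\big(e_i^{(\gamma,\sigma)}(y_i^+,y_{-i},x,\lambda)\big)-F\big(e_i^{(\gamma,\sigma)}(y_i,y_{-i},x,\lambda)\big)\Big]h(\lambda)\,d\lambda.$$ For each fixed $\sigma\in\Sigma$, $\mathcal L_{(\gamma,\sigma)}(y\mid x)$ is log-concave in $\gamma$. Therefore, if $\Gamma$ is convex, then for each $\sigma\in\Sigma$ the slice $$\Gamma_I^*(\sigma)=\big\{\gamma\in\Gamma:\ \phi(y\mid x)\le\mathcal L_{(\gamma,\sigma)}(y\mid x)\ \ \forall y\in\mathcal Y,\ x\in\mathcal X\big\}$$ is convex.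
   Context: Game. Players are $i\in\{1,\ldots,I\}$; player $i$ has a finite ordered action set $\mathcal Y_i=\{s_i^0,s_i^1,\ldots,s_i^{L_i}\}\subseteq\mathbb R$ with $s_i^0<s_i^1<\cdots<s_i^{L_i}$, and $\mathcal Y=\mathcal Y_1\times\cdots\times\mathcal Y_I$. A profile is written $y=(y_i,y_{-i})$. If $y_i=s_i^\ell$, then $y_i^+=s_i^{\ell+1}$, where $s_i^{L_i+1}$ is only a boundary label, not an action. The covariate $x$ takes values in a discrete set $\mathcal X$. The parameter is $(\gamma,\sigma)$ with $\gamma\in\Gamma\subseteq\mathbb R^k$ and $\sigma\in\Sigma$. The unobservables are a common shock $\lambda\in\mathbb R^d$ with Lebesgue density $h$ and a scalar shock $\varepsilon_i\in\mathbb R$ for each player; write $\varepsilon=(\varepsilon_1,\ldots,\varepsilon_I)$. $S_i(\sigma)$ is a $1\times d$ row vector depending only on $\sigma$, and ''$v_i^\gamma(y,x)$ is affine in $\gamma$'' means that $\gamma\mapsto v_i^\gamma(y,x)$ is the restriction to $\Gamma$ of an affine function on $\mathbb R^k$. Thresholds. For $\ell=1,\ldots,L_i$, $$e_i^{(\gamma,\sigma)}(s_i^\ell,y_{-i},x,\lambda)=\frac{V_i^{(\gamma,\sigma)}(s_i^{\ell-1},y_{-i},x,\lambda)-V_i^{(\gamma,\sigma)}(s_i^{\ell},y_{-i},x,\lambda)}{s_i^\ell-s_i^{\ell-1}},$$ with $e_i^{(\gamma,\sigma)}(s_i^0,y_{-i},x,\lambda)=-\infty$, $e_i^{(\gamma,\sigma)}(s_i^{L_i+1},y_{-i},x,\lambda)=+\infty$,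 and the conventions $F(-\infty)=0$, $F(+\infty)=1$. Equilibrium. $G_{(\gamma,\sigma)}(x,\lambda,\varepsilon)$ is the set of pure-strategy Nash equilibria: the set of $y\in\mathcal Y$ such that $u_i^{(\gamma,\sigma)}(y_i,y_{-i},x,\lambda,\varepsilon_i)\ge u_i^{(\gamma,\sigma)}(a_i,y_{-i},x,\lambda,\varepsilon_i)$ for all $a_i\in\mathcal Y_i$ and all $i$. Probabilities. The player-level best-response probability is $$\mathcal M_i^{(\gamma,\sigma)}(y_i\mid y_{-i},x,\lambda)=\Pr_{\varepsilon_i}\big(u_i^{(\gamma,\sigma)}(y_i,y_{-i},x,\lambda,\varepsilon_i)\ge u_i^{(\gamma,\sigma)}(a_i,y_{-i},x,\lambda,\varepsilon_i)\ \text{for all } a_i\in\mathcal Y_i\mid x,\lambda\big).$$ The singleton-event generalized likelihoods are $$\mathcal L_{(\gamma,\sigma)}(y\mid x,\lambda)=\Pr_{\varepsilon}\big(y\in G_{(\gamma,\sigma)}(x,\lambda,\varepsilon)\mid x,\lambda\big),\qquad \mathcal L_{(\gamma,\sigma)}(y\mid x)=\Pr_{\varepsilon,\lambda}\big(y\in G_{(\gamma,\sigma)}(x,\lambda,\varepsilon)\mid x\big).$$ By independence, the conditional probabilities are computed with $x$ (and $\lambda$, where it is conditioned on) held fixed, under the unconditional law of the remaining shocks. Data. $\phi$ is a given vector of conditional choice probabilities: for each $x\in\mathcal X$, $\phi(\cdot\mid x)$ is a probability distribution on $\mathcal Y$. Log-concavity. A nonnegative function $f$ on a subset $C$ of a Euclidean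 space is log-concave if $f((1-t)a+tb)\ge f(a)^{1-t}f(b)^t$ for all $t\in(0,1)$ and all $a,b\in C$ with $(1-t)a+tb\in C$ (zeros are allowed). Functions of $\gamma$ are considered on $\Gamma$. *)

(* Defs.v *)
From HB Require Import structures.
From mathcomp Require Import all_boot all_order all_algebra.
From mathcomp Require Import all_classical all_reals all_analysis.

Set Implicit Arguments.
Unset Strict Implicit.
Unset Printing Implicit Defensive.

Import Order.TTheory GRing.Theory Num.Theory.
Import numFieldNormedType.Exports.

Local Open Scope classical_set_scope.
Local Open Scope ring_scope.

(* R^m is 'cV[R]_m, with the sigma-algebra generated by the coordinates, which
   is the Borel sigma-algebra. *)
Section measurable_cV.
Context {R : realType} (m : nat).

Let coords (i : 'I_m) (v : 'cV[R]_m) : R := v i 0.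

Let cV_set0 : g_sigma_preimage coords set0.
Proof. exact: sigma_algebra0. Qed.

Let cV_setC A : g_sigma_preimage coords A -> g_sigma_preimage coords (~` A).
Proof. exact: sigma_algebraC. Qed.

Let cV_bigcup (F : (set 'cV[R]_m)^nat) :
  (forall i, g_sigma_preimage coords (F i)) ->
  g_sigma_preimage coords (\bigcup_i (F i)).
Proof. exact: sigma_algebra_bigcup. Qed.

HB.instance Definition _ := @isMeasurable.Build default_measure_display
  'cV[R]_m (g_sigma_preimage coords) cV_set0 cV_setC cV_bigcup.

End measurable_cV.

(* Lebesgue measure on R^m: the m-fold product of the one-dimensional one
   (the unit point mass when m = 0). *)
Fixpoint lebesgue_cV (R : realType) (m : nat) : set 'cV[R]_m -> \bar R :=
  match m return set 'cV[R]_m -> \bar R with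
  | 0 => \d_(0 : 'cV[R]_0)
  | m'.+1 => pushforward (@lebesgue_measure R \x @lebesgue_cV R m')%E
      (fun p : R * 'cV[R]_m' => col_mx p.1%:M p.2 : 'cV[R]_m'.+1)
  end.

Section probability_notions.
Context {R : realType} {dT : measure_display} {T : measurableType dT}.
Variable P : probability T R.

Definition sigma_rv d' (T' : measurableType d') (f : T -> T') : set (set T) :=
  preimage_set_system [set: T] f measurable.

Definition independent_pair (F G : set (set T)) : Prop :=
  forall A B, F A -> G B -> (P (A `&` B) = P A * P B)%E.

Definition mutually_independent (J : finType) (F : J -> set (set T)) : Prop :=
  forall (K : {set J}) (A : J -> set T), (forall j, j \in K -> F j (A j)) ->
  P (\bigcap_(j in [set` K]) A j) = (\prod_(j in K) P (A j))%E.

Definition shock_sigma m n (lam : {RV P >-> 'cV[R]_m})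
    (eps : 'I_n -> {RV P >-> R}) (j : option 'I_n) : set (set T) :=
  if j is Some i then sigma_rv (eps i) else sigma_rv lam.

Definition has_lebesgue_density m (X : {RV P >-> 'cV[R]_m})
    (h : 'cV[R]_m -> R) : Prop :=
  [/\ measurable_fun [set: 'cV[R]_m] h, forall v, 0 <= h v &
      forall A : set 'cV[R]_m, measurable A ->
        distribution P X A = (\int[@lebesgue_cV R m]_(v in A) (h v)%:E)%E].

End probability_notions.

Definition affine_on (R : realType) k (C : set 'cV[R]_k) (f : 'cV[R]_k -> R) :=
  exists (a : 'rV[R]_k) (b : R), forall c, C c -> f c = (a *m c) 0 0 + b.

(* The power [`^] satisfies 0 `^ t = 0 for t != 0. *)
Definition log_concave (R : realType) k (C : set 'cV[R]_k) (f : 'cV[R]_k -> R) :=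
  (forall a, C a -> 0 <= f a) /\
  forall (t : R) (a b : 'cV[R]_k), 0 < t -> t < 1 -> C a -> C b ->
    C ((1 - t) *: a + t *: b) ->
    f a `^ (1 - t) * f b `^ t <= f ((1 - t) *: a + t *: b).

Definition logistic (R : realType) (t : R) : R := 1 / (1 + expR (- t)).

Definition logistic_ext (R : realType) (t : \bar R) : R :=
  match t with
  | -oo%E => 0
  | +oo%E => 1
  | r%:E => logistic r
  end.

(* Player i's actions s_i^0 < ... < s_i^{L_i} are [act i l] for l : 'I_(L_i).+1,
   and a profile lists the indices l rather than the real numbers s_i^l. *)
Record ordered_game (R : realType) (X Sigma : Type) (k d : nat) := OrderedGame {
  nplayers : nat;
  top : 'I_nplayers -> nat;
  act : forall i : 'I_nplayers, 'I_(top i).+1 -> R;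
  act_increasing : forall (i : 'I_nplayers) (a b : 'I_(top i).+1),
    (a < b)%N -> act a < act b;
  base_payoff : 'I_nplayers -> {dffun forall i : 'I_nplayers, 'I_(top i).+1} ->
    X -> 'cV[R]_k -> R;
  loading : 'I_nplayers -> Sigma -> 'rV[R]_d
}.

Section game.
Context {R : realType} {X Sigma : Type} {k d : nat}.
Variable g : ordered_game R X Sigma k d.

Local Notation player := 'I_(nplayers g).
Local Notation action i := 'I_(@top _ _ _ _ _ g i).+1.

Definition profile := {dffun forall i : player, action i}.

Definition deviate (y : profile) (i : player) (a : action i) : profile :=
  [ffun j => eqtype.dfwith y a j].

Section payoffs.
Variables (gam : 'cV[R]_k) (sig : Sigma).

Definition V (i : player) (y : profile) (x : X) (lam : 'cV[R]_d) : R :=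
  base_payoff i y x gam + act (y i) * (loading i sig *m lam) 0 0.

Definition u (i : player) (y : profile) (x : X) (lam : 'cV[R]_d) (e : R) : R :=
  V i y x lam + act (y i) * e.

(* [slope i l y] is the slope of V_i between s_i^l and s_i^{l+1}; it is used
   only for l < L_i, and depends on y only through y_{-i}. *)
Definition slope (i : player) (l : nat) (y : profile) (x : X)
    (lam : 'cV[R]_d) : R :=
  let lo : action i := inord l in
  let hi : action i := inord l.+1 in
  (V i (deviate y hi) x lam - V i (deviate y lo) x lam) / (act hi - act lo).

(* e_i(s_i^l, y_{-i}, x, lam) for 0 <= l <= L_i + 1. *)
Definition threshold (i : player) (l : nat) (y : profile) (x : X)
    (lam : 'cV[R]_d) : \bar R :=
  match l with
  | 0 => -oo%E
  | l'.+1 =>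
    if (l'.+1 <= top i)%N then
      let lo : action i := inord l' in
      let hi : action i := inord l'.+1 in
      ((V i (deviate y lo) x lam - V i (deviate y hi) x lam) /
        (act hi - act lo))%:E
    else +oo%E
  end.

Definition best_response (i : player) (y : profile) (x : X) (lam : 'cV[R]_d)
    (e : R) : Prop :=
  forall a : action i, u i (deviate y a) x lam e <= u i y x lam e.

Definition nash (x : X) (lam : 'cV[R]_d) (e : player -> R) : set profile :=
  [set y | forall i, best_response i y x lam (e i)].

Section likelihoods.
Context {dT : measure_display} {T : measurableType dT}.
Variables (P : probability T R) (lam_rv : {RV P >-> 'cV[R]_d}).
Variable eps : player -> {RV P >-> R}.

(* Shocks being independent of the conditioning variables, these conditional
   probabilities hold the conditioning values fixed. *)
Definition br_prob (i : player) (y : profile) (x : X) (lam : 'cV[R]_d) : R :=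
  fine (P [set w | best_response i y x lam (eps i w)]).

Definition cond_likelihood (y : profile) (x : X) (lam : 'cV[R]_d) : R :=
  fine (P [set w | nash x lam (eps ^~ w) y]).

Definition likelihood (y : profile) (x : X) : R :=
  fine (P [set w | nash x (lam_rv w) (eps ^~ w) y]).

End likelihoods.
End payoffs.

Definition strictly_concave_payoffs (Gamma : set 'cV[R]_k) : Prop :=
  forall (i : player) (y : profile) (x : X) (lam : 'cV[R]_d) gam sig (l : nat),
    Gamma gam -> (1 <= l)%N -> (l < top i)%N ->
    slope gam sig i l y x lam < slope gam sig i l.-1 y x lam.

Definition is_ccp (phi : X -> profile -> R) : Prop :=
  forall x, (forall y, 0 <= phi x y) /\ \sum_y phi x y = 1.

Definition identified_slice {dT : measure_display} {T : measurableType dT}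
    (P : probability T R) (lam_rv : {RV P >-> 'cV[R]_d})
    (eps : player -> {RV P >-> R}) (phi : X -> profile -> R) (Gamma : set 'cV[R]_k) (sig : Sigma) :
    set 'cV[R]_k :=
  [set gam | Gamma gam /\
    forall y x, phi x y <= likelihood gam sig lam_rv eps y x].

End game.

(* Main.v *)
(* By strict concavity a player's utility is single-peaked in the own action, so
   [y_i] is a best response exactly when the shock lies between two consecutive
   thresholds, an event of probability F(b) - F(a).  Independence gives the
   product formula, and the joint law of lambda and the vector of shocks, a
   product measure, gives the integral formula.

   For log-concavity, two-term Hoelder inequalities show that F(b) - F(a) is
   log-concave in (a, b).  The thresholds are jointly affine in
   (gamma, lambda), so the integrand is jointly log-concave and Prekopa-Leindler
   applies.  Prekopa-Leindler is proved by induction on the dimension with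
   Tonelli; in dimension one it follows, by integrating over superlevel sets,
   from the Brunn-Minkowski inequality on the line: for compact K and L the set
   sK + tL contains sK + t min L and s max K + tL, which meet in one point. *)

Require Import Defs.
From mathcomp Require Import all_boot all_order all_algebra.
From mathcomp Require Import all_classical all_reals all_analysis.
From mathcomp Require Import measurable_realfun.
From HB Require Import structures.
From mathcomp Require Import ring lra.

Set Implicit Arguments.
Unset Strict Implicit.
Unset Printing Implicit Defensive.

Import Order.TTheory GRing.Theory Num.Theory.
Import numFieldNormedType.Exports.

Local Open Scope classical_set_scope.
Local Open Scope ring_scope.

(** * Log-concavity of logistic increments *)

(** Young's inequality with the conjugate exponents [(1 - t)^-1] and [t^-1], applied to the powers
    [u ^ (1 - t)] and [v ^ t]. *)
Lemma weighted_AMGM (R : realType) (t u v : R) : 0 < t -> t < 1 ->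
  0 <= u -> 0 <= v -> u `^ (1 - t) * v `^ t <= (1 - t) * u + t * v.
Proof.
move=> t0 t1 u0 v0; have s0 : 0 < 1 - t by lra.
have := @conjugate_powR R (u `^ (1 - t)) (v `^ t) (1 - t)^-1 t^-1
  (powR_ge0 _ _) (powR_ge0 _ _).
rewrite !invr_gt0 !invrK -!powRrM !divff ?gt_eqF// !powRr1// => /(_ s0 t0).
by rewrite subrK => /(_ erefl) /le_trans; apply; rewrite mulrC (mulrC v).
Qed.

(** After division by the sums [S] and [S'], AM-GM bounds each term, and the two bounds add up to 1.
    A vanishing sum forces both of its terms to vanish. *)
Lemma hoelder_powR2 (R : realType) (t x x' y y' : R) : 0 < t -> t < 1 ->
  0 <= x -> 0 <= x' -> 0 <= y -> 0 <= y' ->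
  x `^ (1 - t) * x' `^ t + y `^ (1 - t) * y' `^ t <=
  (x + y) `^ (1 - t) * (x' + y') `^ t.
Proof.
move=> t0 t1 x0 x'0 y0 y'0; have s0 : 0 < 1 - t by lra.
have [xy0|xyN0] := eqVneq (x + y) 0.
  have [-> ->] : x = 0 /\ y = 0 by split; lra.
  by rewrite addr0 powR0 ?gt_eqF// !mul0r addr0.
have [xy'0|xyN'0] := eqVneq (x' + y') 0.
  have [-> ->] : x' = 0 /\ y' = 0 by split; lra.
  by rewrite addr0 powR0 ?(gt_eqF t0)// !mulr0 addr0.
have S0 : 0 < x + y by rewrite lt0r xyN0/= addr_ge0.
have S'0 : 0 < x' + y' by rewrite lt0r xyN'0/= addr_ge0.
set S := x + y in S0 *; set S' := x' + y' in S'0 *.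
have H z z' : 0 <= z -> 0 <= z' -> z `^ (1 - t) * z' `^ t <=
    ((1 - t) * (z / S) + t * (z' / S')) * (S `^ (1 - t) * S' `^ t).
  move=> z0 z'0; rewrite -{1}(divfK (lt0r_neq0 S0) z) -{1}(divfK (lt0r_neq0 S'0) z').
  rewrite (powRM _ (divr_ge0 z0 (ltW S0)) (ltW S0)).
  rewrite (powRM _ (divr_ge0 z'0 (ltW S'0)) (ltW S'0)) mulrACA ler_wpM2r ?mulr_ge0 ?powR_ge0//.
  by apply: weighted_AMGM => //; apply: divr_ge0 => //; exact: ltW.
apply: (le_trans (lerD (H _ _ x0 x'0) (H _ _ y0 y'0))).
rewrite -mulrDl; apply: ler_piMl; first by rewrite mulr_ge0 ?powR_ge0.
rewrite addrACA -!mulrDr -!mulrDl !divff ?gt_eqF//; lra.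
Qed.

Lemma powR_interpM (R : realType) (t f f' g x x' y : R) :
  0 <= f -> 0 <= f' -> 0 <= x -> 0 <= x' ->
  f `^ (1 - t) * f' `^ t <= g -> x `^ (1 - t) * x' `^ t <= y ->
  (f * x) `^ (1 - t) * (f' * x') `^ t <= g * y.
Proof.
by move=> *; rewrite !powRM// mulrACA ler_pM// mulr_ge0// powR_ge0.
Qed.

Lemma powR_interp_prod (R : realType) (I : finType) (t : R) (f f' g : I -> R) :
  (forall i, 0 <= f i) -> (forall i, 0 <= f' i) ->
  (forall i, f i `^ (1 - t) * f' i `^ t <= g i) ->
  (\prod_i f i) `^ (1 - t) * (\prod_i f' i) `^ t <= \prod_i g i.
Proof.
(* The invariant carries nonnegativity along with the inequality, since powers distribute over
   products of nonnegative factors only. *)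
move=> f0 f'0 fg; pose K (x y z : R) := [/\ 0 <= x, 0 <= y &
  x `^ (1 - t) * y `^ t <= z].
suff [] : K (\prod_i f i) (\prod_i f' i) (\prod_i g i) by [].
apply: (big_rec3 K); first by split=> //; rewrite !powR1 mulr1.
move=> i x y z _ [x0 y0 xyz]; split; rewrite ?mulr_ge0//.
exact: powR_interpM.
Qed.

Lemma expR_powR (R : realType) (x s : R) : expR x `^ s = expR (s * x).
Proof. by rewrite /powR gt_eqF ?expR_gt0// expRK. Qed.

Lemma powRVl (R : realType) (x s : R) : 0 <= x -> x^-1 `^ s = (x `^ s)^-1.
Proof. by move=> x0; rewrite -powR_inv1// -powRrM mulN1r powRN. Qed.

Section logistic.
Context {R : realType}.
Implicit Types a b t : R.

Lemma logisticE b : logistic b = (1 + expR (- b))^-1.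
Proof. by rewrite /logistic div1r. Qed.

Lemma logistic_ge0 b : 0 <= logistic b.
Proof. by rewrite logisticE invr_ge0 addr_ge0// expR_ge0. Qed.

Lemma logisticN b : 1 - logistic b = logistic (- b).
Proof.
rewrite !logisticE opprK expRN; have := expR_gt0 b => e0.
field; apply/andP; split; lra.
Qed.

Lemma logistic_le1 b : logistic b <= 1.
Proof. by rewrite -subr_ge0 logisticN logistic_ge0. Qed.

(** This factorization isolates an increment of [expR] and two logistic values at reflected
    arguments. Each factor interpolates log-concavely, hence so does the product. *)
Lemma logisticB a b :
  logistic b - logistic a = (expR b - expR a) * (logistic (- a) * logistic (- b)).
Proof.
rewrite !logisticE !opprK !expRN; have := expR_gt0 b; have := expR_gt0 a => a0 b0.
field; apply/and4P; split; lra.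
Qed.

(** Passing to reciprocals turns the claim into the two-term Hoelder inequality for [1 + expR (- b)]
    and [1 + expR (- b')]. *)
Lemma logistic_interp t b b' : 0 < t -> t < 1 ->
  logistic b `^ (1 - t) * logistic b' `^ t <= logistic ((1 - t) * b + t * b').
Proof.
move=> t0 t1; have p z : 0 < 1 + expR (- z) :> R by rewrite addr_gt0// expR_gt0.
rewrite !logisticE !powRVl ?(ltW (p _))// -invfM lef_pV2 ?posrE ?mulr_gt0 ?powR_gt0//.
have := @hoelder_powR2 R t 1 1 (expR (- b)) (expR (- b')) t0 t1 ler01 ler01
  (expR_ge0 _) (expR_ge0 _).
rewrite !powR1 mulr1 !expR_powR -expRD; congr (1 + expR _ <= _); ring.
Qed.

(** Hoelder with the splitting [expR b = expR a + (expR b - expR a)]: the term from [expR a] is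
    exactly an exponential and moves to the other side. *)
Lemma expRB_interp t a b a' b' : 0 < t -> t < 1 -> a <= b -> a' <= b' ->
  (expR b - expR a) `^ (1 - t) * (expR b' - expR a') `^ t <=
  expR ((1 - t) * b + t * b') - expR ((1 - t) * a + t * a').
Proof.
move=> t0 t1 ab ab'.
have := @hoelder_powR2 R t (expR a) (expR a') (expR b - expR a) (expR b' - expR a')
  t0 t1 (expR_ge0 _) (expR_ge0 _).
rewrite !subr_ge0 !ler_expR !subrKC !expR_powR -!expRD => /(_ ab ab').
by rewrite -lerBrDl.
Qed.

Lemma logisticB_ge0 a b : a <= b -> 0 <= logistic b - logistic a.
Proof.
by move=> ab; rewrite logisticB mulr_ge0 ?subr_ge0 ?ler_expR// mulr_ge0 ?logistic_ge0.
Qed.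

Lemma logisticB_interp t a b a' b' : 0 < t -> t < 1 -> a <= b -> a' <= b' ->
  (logistic b - logistic a) `^ (1 - t) * (logistic b' - logistic a') `^ t <=
  logistic ((1 - t) * b + t * b') - logistic ((1 - t) * a + t * a').
Proof.
move=> t0 t1 ab ab'; rewrite !logisticB.
apply: powR_interpM; rewrite ?mulr_ge0 ?logistic_ge0 ?subr_ge0 ?ler_expR//.
  exact: expRB_interp.
have opp z z' : - ((1 - t) * z + t * z') = (1 - t) * - z + t * - z' by ring.
by rewrite !opp; apply: powR_interpM; rewrite ?logistic_ge0// logistic_interp.
Qed.

End logistic.

(** * The Brunn-Minkowski inequality on the line *)

(* The canonical measure structure on [pushforward m f] takes the measurability
   of [f] as an argument that unification cannot find. *)
Definition pushforward_measure d1 d2 (T1 : measurableType d1)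
    (T2 : measurableType d2) (R : realType) (m : {measure set T1 -> \bar R})
    (f : T1 -> T2) (mf : measurable_fun setT f) : {measure set T2 -> \bar R} :=
  measure_function_pushforward__canonical__measure_function_Measure m mf.

Section brunn_minkowski.
Context {R : realType}.
Local Notation mu := (@lebesgue_measure R).

Lemma measurable_affine (c r : R) :
  measurable_fun setT (fun x : R => c * x + r).
Proof. by apply: measurable_funD => //; exact: measurable_funM. Qed.

(** By uniqueness of Lebesgue measure: [c] times the pushforward under the affine map gives
    half-open intervals their length. *)
Lemma lebesgue_measure_affine (c r : R) (A : set R) : 0 < c -> measurable A ->
  mu ((fun x => c * x + r) @^-1` A) = (c^-1%:E * mu A)%E.
Proof.
move=> c0 mA.
pose phi (x : measurableTypeR R) : measurableTypeR R := c * x + r.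
have mphi : measurable_fun setT phi by exact: measurable_affine.
have cge : 0 <= c by exact: ltW.
pose m2 : {measure set (measurableTypeR R) -> \bar R} :=
  mscale (NngNum cge) (pushforward_measure mu mphi).
rewrite (@lebesgue_measure_unique R m2 _ A mA)//=.
  by rewrite /mscale/= muleA -EFinM mulVf ?gt_eqF// mul1e.
move=> _ [[a b]] _ <-; rewrite /m2 /mscale/= /pushforward/=.
rewrite (_ : phi @^-1` _ = `](a - r) / c, (b - r) / c]%classic); last first.
  apply/seteqP; split=> x /=; rewrite !in_itv/= /phi ltr_pdivrMr// ler_pdivlMr//;
  by rewrite ltrBlDr lerBrDr (mulrC c).
rewrite !lebesgue_measure_itv/= !lte_fin ltr_pM2r ?invr_gt0// ltrD2r.
case: ifPn => _; last by rewrite mule0.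
by rewrite -!EFinB -EFinM; congr EFin; field; lra.
Qed.

Lemma compact_max (K : set R) : K !=set0 -> compact K ->
  exists2 k, K k & forall x, K x -> x <= k.
Proof.
move=> K0 cK.
have [|c /set_mem Kc cmax] := @compact_EVT_max R R idfun K K0 cK.
  by apply: continuous_subspaceT => x; exact: cvg_id.
by exists c => // x Kx; apply: cmax; rewrite inE.
Qed.

Lemma compact_min (K : set R) : K !=set0 -> compact K ->
  exists2 k, K k & forall x, K x -> k <= x.
Proof.
move=> K0 cK.
have [|c /set_mem Kc cmin] := @compact_EVT_min R R idfun K K0 cK.
  by apply: continuous_subspaceT => x; exact: cvg_id.
by exists c => // x Kx; apply: cmin; rewrite inE.
Qed.

Lemma compact_measurable_realType (K : set R) : compact K -> measurable K.
Proof.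
by move=> cK; apply: closed_measurable; apply: compact_closed => //; exact: Rhausdorff.
Qed.

(** Lets a supremum be taken in one summand at a time. For finite [c] the other summand [y] is
    finite as well, because [S] is nonempty and nonnegative, and can be subtracted. *)
Lemma ereal_sup_pmulD (S : set \bar R) (s : R) (y c : \bar R) :
  0 < s -> (0 <= y)%E -> S !=set0 -> (forall x, S x -> 0 <= x)%E ->
  (forall x, S x -> s%:E * x + y <= c)%E -> (s%:E * ereal_sup S + y <= c)%E.
Proof.
move=> s0 y0 [x Sx] S0 H; have yc : (y <= c)%E.
  by apply: le_trans (H _ Sx); apply: leeDr; apply: mule_ge0; [rewrite lee_fin ltW|exact: S0].
case: c H yc => [c| |] H yc; last 2 first.
- by rewrite leey.
- by have := le_trans y0 yc; rewrite leeNy_eq.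
have yfin : y \is a fin_num by rewrite ge0_fin_numE// (le_lt_trans yc)// ltry.
rewrite -leeBrDr// -lee_pdivlMl//; apply: ge_ereal_sup => z Sz.
by rewrite lee_pdivlMl// leeBrDr// H.
Qed.

Lemma brunn_minkowski_compact (s t : R) (K L C : set R) : 0 < s -> 0 < t ->
  compact K -> compact L -> K !=set0 -> L !=set0 -> measurable C ->
  (forall x y, K x -> L y -> C (s * x + t * y)) ->
  (s%:E * mu K + t%:E * mu L <= mu C)%E.
Proof.
move=> s0 t0 cK cL K0 L0 mC KLC.
have [k Kk kmax] := compact_max K0 cK.
have [l Ll lmin] := compact_min L0 cL.
have mK := compact_measurable_realType cK.
have mL := compact_measurable_realType cL.
(* [K'] is [s K + t l] and [L'] is [s k + t L], written as preimages so that the affine scaling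
   formula gives their measures. Both lie in [C], on either side of [p = s k + t l]. *)
pose K' := (fun z => s^-1 * z + - (s^-1 * (t * l))) @^-1` K.
pose L' := (fun z => t^-1 * z + - (t^-1 * (s * k))) @^-1` L.
have muK' : mu K' = (s%:E * mu K)%E by rewrite lebesgue_measure_affine ?invr_gt0// invrK.
have muL' : mu L' = (t%:E * mu L)%E by rewrite lebesgue_measure_affine ?invr_gt0// invrK.
have mK' : measurable K' by rewrite -[K']setTI; exact: measurable_affine.
have mL' : measurable L' by rewrite -[L']setTI; exact: measurable_affine.
pose p := s * k + t * l.
have K'p z : K' z -> z <= p.
  move=> /kmax; rewrite -mulrBr mulrC ler_pdivrMr// lerBlDr; rewrite /p; lra.
have L'p z : L' z -> p <= z.
  move=> /lmin; rewrite -mulrBr mulrC ler_pdivlMr//; rewrite /p; lra.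
have K'C : K' `<=` C.
  move=> z /KLC /(_ Ll); congr C; field; lra.
have L'C : L' `<=` C.
  move=> z /(KLC _ _ Kk); congr C; field; lra.
rewrite -muK' -muL'.
have mp : measurable [set p] by [].
(* Deleting the null point [p] makes the two sets disjoint at no cost in measure. *)
have -> : mu K' = mu (K' `\` [set p]).
  apply/eqP; rewrite eq_le; apply/andP; split; last first.
    by rewrite le_measure ?inE//; exact: measurableD.
  rewrite -[leRHS]adde0 -(lebesgue_measure_set1 p).
  apply: le_trans (measureU2 _ _ _) => //; last exact: measurableD.
  rewrite le_measure ?inE//; first by apply: measurableU => //; exact: measurableD.
  by move=> z K'z; have [->|/eqP zp] := eqVneq z p; [right|left].
rewrite -measureU//; last 2 first.
- exact: measurableD.
- apply/seteqP; split=> // z [[/K'p zp pz] /L'p pz'].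
  by apply: pz => /=; apply/eqP; rewrite eq_le zp pz'.
apply: le_measure; rewrite ?inE//; first by apply: measurableU => //; exact: measurableD.
by move=> z [[/K'C]|/L'C].
Qed.

Lemma brunn_minkowski1 (s t : R) (A B C : set R) : 0 < s -> 0 < t ->
  measurable A -> measurable B -> A !=set0 -> B !=set0 -> measurable C ->
  (forall x y, A x -> B y -> C (s * x + t * y)) ->
  (s%:E * mu A + t%:E * mu B <= mu C)%E.
Proof.
move=> s0 t0 mA mB [a Aa] [b Bb] mC ABC.
have cpt1 (K : set R) z : compact K -> compact (K `|` [set z]).
  by move=> cK; apply: compactU => //; exact: compact_set1.
have mono (K : set R) z : compact K -> (mu K <= mu (K `|` [set z]))%E.
  move=> cK; apply: le_measure; rewrite ?inE.
  - exact: compact_measurable_realType.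
  - by apply: compact_measurable_realType; exact: cpt1.
  - by move=> ? ?; left.
have s0' : (0 <= s%:E)%E by rewrite lee_fin ltW.
have t0' : (0 <= t%:E)%E by rewrite lee_fin ltW.
rewrite (lebesgue_regularity_inner_sup mA) (lebesgue_regularity_inner_sup mB).
have KL K L : compact K -> compact L -> K `<=` A -> L `<=` B ->
    (s%:E * mu K + t%:E * mu L <= mu C)%E.
  move=> cK cL KA LB.
  (* Inner regularity may offer empty compact sets. Adjoining the points [a] and [b] keeps them
     compact, makes them nonempty and does not lower the measure. *)
  apply: (@le_trans _ _ (s%:E * mu (K `|` [set a]) + t%:E * mu (L `|` [set b]))%E).
    by rewrite leeD// lee_pmul2l// ?lte_fin// mono.
  apply: brunn_minkowski_compact => //; [exact: cpt1|exact: cpt1| | |].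
  - by exists a; right.
  - by exists b; right.
  - by move=> x y Kx Ly; apply: ABC; [case: Kx => [/KA|/= ->]|case: Ly => [/LB|/= ->]].
have ne (D : set R) : [set mu K | K in [set K | compact K /\ K `<=` D]] !=set0.
  by exists (mu set0), set0 => //; split=> //; exact: compact0.
apply: ereal_sup_pmulD => //.
- by rewrite -(lebesgue_regularity_inner_sup mB) mule_ge0.
- by move=> _ [K _ <-].
move=> _ [K [cK KA] <-]; rewrite addeC; apply: ereal_sup_pmulD => //.
- exact: mule_ge0.
- by move=> _ [L _ <-].
by move=> _ [L [cL LB] <-]; rewrite addeC; exact: KL.
Qed.

End brunn_minkowski.

(** * The Prekopa-Leindler inequality *)

(* With values in [0, +oo], [p] and [q] range over the positive reals below
   [a] and [b]: this avoids the products [0 * +oo] of the literal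
   [a `^ (1 - t) * b `^ t <= c], to which it is equivalent for finite values. *)
Definition geometric_mean_le (R : realType) (t : R) (a b c : \bar R) :=
  forall p q : R, 0 < p -> 0 < q -> (p%:E < a)%E -> (q%:E < b)%E ->
  ((p `^ (1 - t) * q `^ t)%:E <= c)%E.

(** Both sides are the product measure of [A]: Tonelli for its indicator. *)
Lemma integral_sections d1 d2 (T1 : measurableType d1) (T2 : measurableType d2)
    (R : realType) (m1 : {sigma_finite_measure set T1 -> \bar R})
    (m2 : {sigma_finite_measure set T2 -> \bar R}) (A : set (T1 * T2)) :
  measurable A ->
  (\int[m1]_x m2 (xsection A x) = \int[m2]_y m1 (ysection A y))%E.
Proof.
move=> mA; have := indic_fubini_tonelli m1 m2 mA.
by rewrite indic_fubini_tonelli_FE// indic_fubini_tonelli_GE.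
Qed.

(** * The layer-cake formula for truncated functions *)

Section layer_cake.
Context {R : realType}.
Local Notation mu := (@lebesgue_measure R).
Local Notation borelR := (measurableTypeR R).
Implicit Types (f : borelR -> \bar R) (a : R) (s x : borelR).

(** Heights are written [a * s] with [s] in [0, 1), so that functions truncated at different heights
    can be compared at the same [s]. *)
Definition level_region f a : set (borelR * borelR) :=
  [set z | 0 <= (z.1 : R) < 1 /\ ((a * z.1)%:E < f z.2)%E].

Definition level_size f a s : \bar R := mu (xsection (level_region f a) s).

Lemma measurable_level_region f a :
  measurable_fun setT f -> measurable (level_region f a).
Proof.
move=> mf; rewrite (_ : level_region f a =
  ((`[0%R, 1%R[%classic : set borelR) `*` setT) `&` (setT `&` [set z | ((a * z.1)%:E < f z.2)%E])).
  apply: measurableI; first exact: measurableX.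
  apply: measurable_lte => //.
    apply/measurable_EFinP; apply: measurable_funM => //.
  exact: measurableT_comp.
apply/seteqP; split => z /=; rewrite in_itv/=; last by case=> -[? _] [].
by case.
Qed.

Lemma measurable_level_size f a :
  measurable_fun setT f -> measurable_fun setT (level_size f a).
Proof.
by move=> mf; apply: measurable_fun_xsection; exact: measurable_level_region.
Qed.

Lemma level_size_ge0 f a s : (0 <= level_size f a s)%E.
Proof. exact: measure_ge0. Qed.

(** For fixed [x] the admissible [s] form the interval from 0 to the smaller of 1 and [f x / a]. *)
Lemma level_ysection f a x : 0 < a -> (0 <= f x)%E ->
  (a%:E * mu (ysection (level_region f a) x) = mine (f x) a%:E)%E.
Proof.
move=> a0 fx0.
have itvE (b : R) : (forall s : borelR, 0 <= (s : R) < 1 -> (((a * s)%:E < f x)%E <-> (s : R) < b)) ->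
    ysection (level_region f a) x = `[0, Num.min 1 b[%classic.
  move=> H; apply/seteqP; split=> s; rewrite /ysection/= inE/= in_itv/= lt_min.
    by case=> /[dup] s01 /andP[-> ->] /H -> //.
  by move=> /and3P[s0 s1 sb]; split; [rewrite s0|apply/H; rewrite ?s0].
have [fxa|fxa] := leP (f x) a%:E.
  have ffin : f x \is a fin_num by rewrite ge0_fin_numE// (le_lt_trans fxa)// ltry.
  move: fx0 fxa itvE; rewrite -(fineK ffin); set r := fine (f x) => r0.
  rewrite lee_fin => ra itvE; rewrite (itvE (r / a)); last first.
    by move=> s _; rewrite lte_fin ltr_pdivlMr// mulrC.
  rewrite min_r ?ler_pdivrMr ?mul1r// lebesgue_measure_itv/= lte_fin.
  rewrite pmulr_lgt0 ?invr_gt0//; case: ifPn => [_|].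
    by rewrite sube0 -EFinM mulrC divfK ?gt_eqF.
  by rewrite -leNgt mule0 => rle0; congr EFin; apply/eqP; rewrite eq_le rle0 -lee_fin r0.
rewrite (itvE 1); last first.
  move=> s /andP[_ s1]; split=> // _; apply: le_lt_trans fxa.
  by rewrite lee_fin ger_pMr// ltW.
by rewrite minxx lebesgue_measure_itv/= lte_fin ltr01 sube0 mule1.
Qed.

Lemma layer_cake f a : 0 < a -> measurable_fun setT f ->
  (forall x, 0 <= f x)%E ->
  (\int[mu]_x mine (f x) a%:E = a%:E * \int[mu]_s level_size f a s)%E.
Proof.
move=> a0 mf f0.
transitivity (\int[mu]_x (a%:E * mu (ysection (level_region f a) x)))%E.
  by apply: eq_integral => x _; rewrite level_ysection.
have mS := measurable_level_region a mf.
rewrite ge0_integralZl; [|exact: measurableT|exact: measurable_fun_ysection| |].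
- by rewrite /level_size -(integral_sections _ _ mS).
- by move=> x _; exact: measure_ge0.
- by rewrite lee_fin ltW.
Qed.

(** The truncation height must lose little of the integral and yet leave every superlevel set below
    it nonempty, as Brunn-Minkowski requires. The supremum of [f] does this if [f] is bounded; a
    large integer does it otherwise. *)
Lemma integral_truncation f (p : R) : measurable_fun setT f ->
  (forall x, 0 <= f x)%E -> 0 < p -> (p%:E < \int[mu]_x f x)%E ->
  exists a, [/\ 0 < a, forall s, s < a -> exists x, (s%:E < f x)%E &
    (p%:E < \int[mu]_x mine (f x) a%:E)%E].
Proof.
move=> mf f0 p0 pf.
have [[M fM]|unb] := pselect (exists M : R, forall x, (f x <= M%:E)%E).
  have supM : (ereal_sup (range f) <= M%:E)%E by apply: ge_ereal_sup => _ [x _ <-].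
  have fsup x : (f x <= ereal_sup (range f))%E by apply: ereal_sup_ubound; exists x.
  have sup0 := le_trans (f0 0) (fsup 0).
  have supfin : ereal_sup (range f) \is a fin_num.
    by rewrite ge0_fin_numE// (le_lt_trans supM)// ltry.
  exists (fine (ereal_sup (range f))); rewrite fineK//.
  have minE x : mine (f x) (ereal_sup (range f)) = f x by rewrite min_l.
  split; last by under eq_integral do rewrite minE.
  (* A zero supremum would make the integral zero, against [0 < p]. *)
  - apply: fine_gt0; rewrite (le_lt_trans supM (ltry _)) andbT lt0e sup0 andbT.
    apply/eqP => s0; move: pf; rewrite integral0_eq ?lte_fin 1?ltNge ?(ltW p0)//.
    by move=> x _; apply/eqP; rewrite eq_le f0 -s0 fsup.
  - move=> s; rewrite -lte_fin fineK// => /ereal_sup_gt[_ [x _ <-] sx].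
    by exists x.
have {}unb M : exists x, (M%:E < f x)%E.
  apply: contrapT => H; apply: unb; exists M => x; rewrite leNgt.
  by apply/negP => Mx; apply: H; exists x.
(* Truncations at [n.+1], which is always positive, increase to [f]; were all their integrals at
   most [p], monotone convergence would bound the integral of [f] by [p]. *)
suff [n pn] : exists n, (p%:E < \int[mu]_x mine (f x) n.+1%:R%:E)%E.
  by exists n.+1%:R; split => // s _; exact: unb.
apply: contrapT => H; move: pf; apply/negP; rewrite -leNgt.
pose g n x := mine (f x) n.+1%:R%:E.
have nd x : nondecreasing_seq (g ^~ x).
  move=> m n mn; rewrite /g le_min ge_min lexx/= ge_min.
  by rewrite lee_fin ler_nat ltnS mn orbT.
have gf x : limn (g ^~ x) = f x.
  have := f0 x; rewrite /g; case: (f x) => [r| |] r0 //.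
    apply: lim_near_cst => //.
    near=> n; rewrite min_l// lee_fin; apply: ltW.
    by apply: (@lt_trans _ _ n%:R); [near: n; exact: nbhs_infty_gtr|rewrite ltr_nat].
  apply/cvg_lim => //; apply/cvgeyPge => A; near=> n.
  rewrite min_r ?leey// lee_fin; apply: ltW.
  by apply: (@lt_trans _ _ n%:R); [near: n; exact: nbhs_infty_gtr|rewrite ltr_nat].
have g0 n x : (0 <= g n x)%E by rewrite /g le_min f0 lee_fin ler0n.
have mg n : measurable_fun setT (g n) by apply: measurable_mine => //; exact: measurable_cst.
under eq_integral do rewrite -gf.
rewrite monotone_convergence//.
apply: lime_le.
  apply: ereal_nondecreasing_is_cvgn => m n mn; apply: ge0_le_integral => //.
  by move=> x _; exact: nd.
apply: nearW => n; rewrite leNgt; apply/negP => pn; apply: H; by exists n.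
Unshelve. all: by end_near. Qed.

End layer_cake.

Section prekopa_leindler1.
Context {R : realType}.
Local Notation borelR := (measurableTypeR R).
Local Notation mu := (@lebesgue_measure R).
Implicit Types (f g h : borelR -> \bar R).

(** With [c = a ^ (1 - t) * b ^ t], the height [c * s] is the geometric mean of [a * s] and [b * s].
    Hence superlevel sets of [f] and [g] at those heights combine into one of [h], and
    Brunn-Minkowski compares their sizes. *)
Lemma level_size_le f g h (t a b : R) (s : borelR) : 0 < t -> t < 1 ->
  0 < a -> 0 < b ->
  measurable_fun setT f -> measurable_fun setT g -> measurable_fun setT h ->
  (forall r, r < a -> exists x, (r%:E < f x)%E) ->
  (forall r, r < b -> exists x, (r%:E < g x)%E) ->
  (forall x y : R, geometric_mean_le t (f x) (g y) (h ((1 - t) * x + t * y))) ->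
  ((1 - t)%:E * level_size f a s + t%:E * level_size g b s <=
   level_size h (a `^ (1 - t) * b `^ t) s)%E.
Proof.
move=> t0 t1 a0 b0 mf mg mh fa gb fgh; set c := a `^ (1 - t) * b `^ t.
have c0 : 0 < c by rewrite mulr_gt0 ?powR_gt0.
have secE k e : xsection (level_region k e) s =
    [set x | 0 <= (s : R) < 1 /\ ((e * s)%:E < k x)%E].
  by apply/seteqP; split=> x; rewrite /xsection/= inE.
have msec k e : measurable_fun setT k ->
    measurable (xsection (level_region k e) s).
  by move=> mk; apply: measurable_xsection; exact: measurable_level_region.
have [s01|s01] := boolP (0 <= (s : R) < 1); last first.
  have level0 k e : level_size k e s = 0%E.
    rewrite /level_size secE (_ : [set _ | _] = set0) ?measure0//.
    by apply/seteqP; split=> // x [s01']; move: s01; rewrite s01'.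
  by rewrite !level0 !mule0 adde0.
have /andP[s0 s1] := s01.
apply: brunn_minkowski1; rewrite ?subr_gt0//; [exact: msec|exact: msec| | |exact: msec|].
- by have [|x fx] := fa (a * s); [rewrite gtr_pMr|exists x; rewrite secE].
- by have [|x fx] := gb (b * s); [rewrite gtr_pMr|exists x; rewrite secE].
move=> x y; rewrite !secE => -[_ fx] [_ gy]; split=> //.
(* [geometric_mean_le] takes positive numbers and yields a weak inequality, while [s] may be 0 and
   the superlevel sets are strict; so [p] and [q] are chosen strictly between the heights and the
   values. *)
have below (r : R) (z : \bar R) : 0 <= r -> (r%:E < z)%E ->
    exists p, [/\ 0 < p, r < p & (p%:E < z)%E].
  move=> r0; case: z => [z| |]//.
    by rewrite lte_fin => rz; exists ((r + z) / 2); rewrite lte_fin; split; lra.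
  by move=> _; exists (r + 1); rewrite ltry; split=> //; lra.
have [p [p0 ap pf]] := below _ _ (mulr_ge0 (ltW a0) s0) fx.
have [q [q0 bq qg]] := below _ _ (mulr_ge0 (ltW b0) s0) gy.
apply: lt_le_trans (fgh _ _ _ _ p0 q0 pf qg); rewrite lte_fin.
have -> : c * s = (a * s) `^ (1 - t) * (b * s) `^ t.
  rewrite !powRM ?(ltW a0) ?(ltW b0)// mulrACA -powRD ?subrK ?oner_eq0//.
  by rewrite powRr1.
apply: (@le_lt_trans _ _ ((a * s) `^ (1 - t) * q `^ t)).
  rewrite ler_wpM2l ?powR_ge0// ge0_ler_powR ?nnegrE ?(ltW t0)// ?(ltW bq) ?(ltW q0)//.
  by rewrite mulr_ge0// ltW.
rewrite ltr_pM2r ?powR_gt0// gt0_ltr_powR ?subr_gt0 ?nnegrE//; last exact: ltW.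
by rewrite mulr_ge0// ltW.
Qed.

(** Dividing by the truncation heights [a] and [b] puts [f] and [g] on a common scale. There
    Brunn-Minkowski yields an arithmetic mean of the normalized integrals, which dominates the
    geometric mean; multiplying back by [c] bounds the integral of [mine (h x) c]. *)
Lemma prekopa_leindler1 f g h (t : R) : 0 < t -> t < 1 ->
  measurable_fun setT f -> measurable_fun setT g -> measurable_fun setT h ->
  (forall x, 0 <= f x)%E -> (forall x, 0 <= g x)%E -> (forall x, 0 <= h x)%E ->
  (forall x y : R, geometric_mean_le t (f x) (g y) (h ((1 - t) * x + t * y))) ->
  geometric_mean_le t (\int[mu]_x f x) (\int[mu]_x g x) (\int[mu]_x h x).
Proof.
move=> t0 t1 mf mg mh f0 g0 h0 fgh p q p0 q0 pf qg.
have s0 : 0 < 1 - t by lra.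
have [a [a0 fa pfa]] := integral_truncation mf f0 p0 pf.
have [b [b0 gb qgb]] := integral_truncation mg g0 q0 qg.
set c := a `^ (1 - t) * b `^ t.
have c0 : 0 < c by rewrite mulr_gt0 ?powR_gt0.
have Lle : ((1 - t)%:E * \int[mu]_s level_size f a s +
    t%:E * \int[mu]_s level_size g b s <= \int[mu]_s level_size h c s)%E.
  have ml k e : measurable_fun setT k -> measurable_fun setT (level_size k e).
    exact: measurable_level_size.
  rewrite -!ge0_integralZl//; first last.
  all: try by [exact: ml|move=> x _; exact: level_size_ge0|rewrite lee_fin ltW].
  have ge (r : R) k e x : 0 < r -> (0 <= r%:E * level_size k e x)%E.
    by move=> r0; rewrite mule_ge0 ?level_size_ge0// lee_fin ltW.
  have mz (r : R) k e : measurable_fun setT k ->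
      measurable_fun setT (fun x => r%:E * level_size k e x)%E.
    by move=> mk; apply: measurable_funeM; exact: ml.
  rewrite -ge0_integralD//; first last.
  all: try by [exact: mz|move=> x _; exact: ge].
  apply: ge0_le_integral => //.
  - by move=> x _; rewrite adde_ge0// ge.
  - by apply: emeasurable_funD; exact: mz.
  - exact: ml.
  - by move=> s _; exact: level_size_le.
have pa : ((p / a)%:E <= \int[mu]_s level_size f a s)%E.
  by rewrite mulrC EFinM lee_pdivrMl// -layer_cake// ltW.
have qb : ((q / b)%:E <= \int[mu]_s level_size g b s)%E.
  by rewrite mulrC EFinM lee_pdivrMl// -layer_cake// ltW.
apply: (@le_trans _ _ (\int[mu]_x mine (h x) c%:E)%E); last first.
  apply: ge0_le_integral => //.
  - by move=> x _; rewrite le_min h0 lee_fin ltW.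
  - by apply: measurable_mine => //; exact: measurable_cst.
  - by move=> x _; rewrite ge_min lexx.
rewrite layer_cake//.
have -> : p `^ (1 - t) * q `^ t = c * ((p / a) `^ (1 - t) * (q / b) `^ t).
  rewrite /c mulrACA -!powRM ?divr_ge0 ?(ltW p0) ?(ltW a0) ?(ltW q0) ?(ltW b0)//.
  by rewrite (mulrC a) (mulrC b) !divfK ?gt_eqF.
rewrite EFinM; apply: lee_wpmul2l; first by rewrite lee_fin ltW.
apply: le_trans Lle.
apply: (@le_trans _ _ ((1 - t) * (p / a) + t * (q / b))%:E).
  by rewrite lee_fin weighted_AMGM// divr_ge0// ltW.
by rewrite EFinD !EFinM leeD// lee_pmul2l// lte_fin.
Qed.

End prekopa_leindler1.

(** * Measurability, Lebesgue measure and iterated integrals on column vectors *)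

Section measurable_cV_coordinates.
Context {R : realType}.

Lemma measurable_cV_coord m (i : 'I_m) :
  measurable_fun setT (fun v : 'cV[R]_m => v i 0).
Proof.
move=> _ Y mY; rewrite setTI; apply: sub_sigma_algebra => /=.
rewrite -bigcup_seq/=; exists i => /=; first by rewrite mem_index_enum.
by exists Y => //; rewrite setTI.
Qed.

Lemma measurable_fun_cV d (T : measurableType d) m (f : T -> 'cV[R]_m) :
  (forall i, measurable_fun setT (fun w => f w i 0)) -> measurable_fun setT f.
Proof.
move=> mf; apply: (measurability (\big[setU/set0]_(i < m)
  preimage_set_system setT (fun v : 'cV[R]_m => v i 0) measurable)) => //.
move=> _ [B + <-]; rewrite -bigcup_seq => -[i _ [C mC <-]].
by rewrite setTI; have := mf i measurableT _ mC; rewrite !setTI.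
Qed.

Lemma measurable_col_mx m :
  measurable_fun setT (fun p : measurableTypeR R * 'cV[R]_m =>
    col_mx (p.1 : R)%:M p.2 : 'cV[R]_m.+1).
Proof.
apply: measurable_fun_cV => i; case: (split_ordP (i : 'I_(1 + m))) => j ->.
  rewrite (_ : (fun _ => _) = fst); first exact: measurable_fst.
  apply/funext => p; apply: etrans; first exact: col_mxEu.
  by rewrite ord1 mxE eqxx mulr1n.
rewrite (_ : (fun _ => _) = (fun v : 'cV[R]_m => v j 0) \o snd).
  by apply: measurableT_comp => //; exact: measurable_cV_coord.
by apply/funext => p; exact: col_mxEd.
Qed.

Lemma measurable_behead_cV m :
  measurable_fun setT (fun v : 'cV[R]_m.+1 => (dsubmx (v : 'cV[R]_(1 + m)))).
Proof.
apply: measurable_fun_cV => i; under eq_fun do rewrite mxE.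
exact: measurable_cV_coord.
Qed.

Lemma col_mx_head m (x : R) (v : 'cV[R]_m) : (col_mx x%:M v : 'cV[R]_m.+1) 0 0 = x.
Proof.
have -> : (0 : 'I_m.+1) = lshift m (0 : 'I_1) by exact: val_inj.
by apply: etrans (col_mxEu _ _ _ _) _; rewrite mxE mulr1n.
Qed.

(** The recursion defining [lebesgue_cV] yields a bare set function; this supplies the sigma-finite
    measure structure that Tonelli needs. *)
Lemma lebesgue_cV_measure m :
  exists mu : {sigma_finite_measure set 'cV[R]_m -> \bar R},
    @lebesgue_cV R m = mu.
Proof.
elim: m => [|m [mu IH]].
  by exists (\d_(0 : 'cV[R]_0)).
pose nu := pushforward_measure (@lebesgue_measure R \x mu)%E (@measurable_col_mx m).
have snu : sigma_finite setT nu.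
  have /sigma_finiteP[F [FT ndF Foo]] := sigma_finiteT (@lebesgue_measure R).
  have /sigma_finiteP[G [GT ndG Goo]] := sigma_finiteT mu.
  (* [psi] inverts [col_mx], so preimages of rectangles of finite measure exhaust the space and have
     finite pushforward measure. *)
  pose psi (v : 'cV[R]_m.+1) : measurableTypeR R * 'cV[R]_m :=
    (v 0 0, dsubmx (v : 'cV[R]_(1 + m))).
  have mpsi : measurable_fun setT psi.
    by apply/measurable_fun_pairP; split; [exact: measurable_cV_coord|exact: measurable_behead_cV].
  exists (fun n => psi @^-1` (F n `*` G n)).
    apply/esym/seteqP; split=> // v _.
    have : setT (psi v).1 by [].
    rewrite FT => -[a _ Fa]; have : setT (psi v).2 by [].
    rewrite GT => -[b _ Gb]; exists (maxn a b) => //; split.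
    - by move: Fa; apply/subsetPset/ndF/leq_maxl.
    - by move: Gb; apply/subsetPset/ndG/leq_maxr.
  move=> n; have [mF Fn] := Foo n; have [mG Gn] := Goo n; split.
    by rewrite -[_ @^-1` _]setTI; apply: mpsi => //; exact: measurableX.
  rewrite /nu/= /pushforward/= (_ : _ @^-1` _ = F n `*` G n).
    by rewrite product_measure1E// lte_mul_pinfty// ge0_fin_numE.
  by apply/seteqP; split=> -[x v]; rewrite /psi/= col_mxKd col_mx_head.
exists (HB.pack_for (SigmaFiniteMeasure.type 'cV[R]_m.+1 R) (Measure.sort nu)
  (Measure_isSigmaFinite.Build _ _ _ (Measure.sort nu) snu)).
by rewrite /= IH.
Qed.

Lemma integral_lebesgue_cV0 (f : 'cV[R]_0 -> \bar R) :
  measurable_fun setT f -> (\int[@lebesgue_cV R 0]_v f v = f 0%R)%E.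
Proof. by move=> mf; rewrite integral_dirac// diracT mul1e. Qed.

Lemma integral_lebesgue_cVS m (f : 'cV[R]_m.+1 -> \bar R) :
  measurable_fun setT f -> (forall v, 0 <= f v)%E ->
  (\int[@lebesgue_cV R m.+1]_v f v =
   \int[@lebesgue_measure R]_x \int[@lebesgue_cV R m]_v
     f (col_mx (x : R)%:M v : 'cV[R]_m.+1))%E.
Proof.
move=> mf f0; have [mu E] := lebesgue_cV_measure m.
have -> : @lebesgue_cV R m.+1 = pushforward (@lebesgue_measure R \x mu)%E
    (fun p => col_mx (p.1 : R)%:M p.2 : 'cV[R]_m.+1) by rewrite /= E.
rewrite ge0_integral_pushforward//; last exact: measurable_col_mx.
rewrite E preimage_setT fubini_tonelli1//; last by move=> p; exact: f0.
by apply: measurableT_comp => //; exact: measurable_col_mx.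
Qed.

Lemma measurable_lebesgue_cV_section m (f : 'cV[R]_m.+1 -> \bar R) :
  measurable_fun setT f -> (forall v, 0 <= f v)%E ->
  measurable_fun setT (fun x : measurableTypeR R =>
    \int[@lebesgue_cV R m]_v f (col_mx (x : R)%:M v : 'cV[R]_m.+1))%E.
Proof.
move=> mf f0; have [mu E] := lebesgue_cV_measure m; rewrite E.
apply: (@measurable_fun_fubini_tonelli_F _ _ _ _ _ mu
  (fun p : measurableTypeR R * 'cV[R]_m => f (col_mx (p.1 : R)%:M p.2))) => //.
by apply: measurableT_comp => //; exact: measurable_col_mx.
Qed.

End measurable_cV_coordinates.

Theorem prekopa_leindler (R : realType) m (f g h : 'cV[R]_m -> \bar R) (t : R) :
  0 < t -> t < 1 ->
  measurable_fun setT f -> measurable_fun setT g -> measurable_fun setT h ->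
  (forall v, 0 <= f v)%E -> (forall v, 0 <= g v)%E -> (forall v, 0 <= h v)%E ->
  (forall v w, geometric_mean_le t (f v) (g w) (h ((1 - t) *: v + t *: w))) ->
  geometric_mean_le t (\int[@lebesgue_cV R m]_v f v)
    (\int[@lebesgue_cV R m]_v g v) (\int[@lebesgue_cV R m]_v h v).
Proof.
move=> t0 t1; elim: m f g h => [|m IH] f g h mf mg mh f0 g0 h0 fgh.
  rewrite !integral_lebesgue_cV0//.
  by have := fgh 0 0; rewrite !scaler0 addr0.
rewrite !integral_lebesgue_cVS//.
have mcol (k : 'cV[R]_m.+1 -> \bar R) (x : R) : measurable_fun setT k ->
    measurable_fun setT (fun v : 'cV[R]_m => k (col_mx x%:M v : 'cV[R]_m.+1)).
  move=> mk; apply: measurableT_comp => //.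
  exact: (measurableT_comp (@measurable_col_mx R m) (pair1_measurable x)).
(* The one-dimensional inequality is applied to the inner integrals as functions of the first
   coordinate. They may be infinite, which the extended-real form permits; the induction hypothesis
   on sections supplies its premise. *)
apply: prekopa_leindler1 => //; try exact: measurable_lebesgue_cV_section.
- by move=> x; have [mu ->] := lebesgue_cV_measure (R := R) m; exact: integral_ge0.
- by move=> x; have [mu ->] := lebesgue_cV_measure (R := R) m; exact: integral_ge0.
- by move=> x; have [mu ->] := lebesgue_cV_measure (R := R) m; exact: integral_ge0.
move=> x y; apply: IH => //; try exact: mcol.
move=> v w; have := fgh (col_mx x%:M v) (col_mx y%:M w).
by rewrite !(@scale_col_mx _ 1 m) (@add_col_mx _ 1 m) !scale_scalar_mx -raddfD.
Qed.

(** * Best responses and thresholds *)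

(** [c l.+1] is the cutoff for stepping from [l] to [l.+1]. As cutoffs increase, the steps of [U]
    change sign at most once, so comparison with the two neighbours of [m] decides the maximum. *)
Lemma argmax_single_peaked (R : realType) (n m : nat) (U c : nat -> R) (e : R) :
  (m <= n)%N ->
  (forall l, (l < n)%N -> (U l <= U l.+1) = (c l.+1 <= e)) ->
  (forall l, (l < n)%N -> (U l.+1 <= U l) = (e <= c l.+1)) ->
  (forall l, (0 < l)%N -> (l < n)%N -> c l < c l.+1) ->
  (forall a, (a <= n)%N -> U a <= U m) <->
  ((0 < m)%N -> c m <= e) /\ ((m < n)%N -> e <= c m.+1).
Proof.
move=> mn up down cinc; split=> [max|[lo hi] a an].
  split=> [m0|mn']; last by rewrite -down ?max.
  by rewrite -(prednK m0) -up ?prednK// max// (leq_trans (leq_pred _)).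
have [am|/ltnW ma] := leqP a m.
  (* Induction on the distance from [m], carrying the cutoff inequality that justifies the next step
     away; [above] is the mirror image. *)
  have below k : (k <= m)%N -> U (m - k)%N <= U m /\ ((k < m)%N -> c (m - k)%N <= e).
    elim: k => [_|k IH km]; first by rewrite subn0.
    have [Uk /(_ km) ck] := IH (ltnW km).
    have mk : (m - k = (m - k.+1).+1)%N by rewrite subnSK.
    have mkn : (m - k.+1 < n)%N by rewrite -mk (leq_trans (leq_subr _ _)).
    split; first by rewrite (le_trans _ Uk)// mk up// -mk.
    move=> k1m; apply: le_trans ck; apply: ltW; rewrite mk cinc// subn_gt0//.
  by have [] := below (m - a)%N (leq_subr _ _); rewrite subKn.
have above k : (m + k <= n)%N ->
    U (m + k)%N <= U m /\ ((m + k < n)%N -> e <= c (m + k).+1).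
  elim: k => [_|k IH km]; first by rewrite addn0.
  rewrite addnS in km *; have [Uk /(_ km) ck] := IH (ltnW km).
  split; first by rewrite (le_trans _ Uk)// down.
  by move=> k1n; apply: le_trans ck _; rewrite ltW// cinc.
by have [] := above (a - m)%N; rewrite subnKC.
Qed.

Section best_response.
Context {R : realType} {X Sigma : Type} {k d : nat}.
Variables (g : ordered_game R X Sigma k d) (gam : 'cV[R]_k) (sig : Sigma).
Implicit Types (i : 'I_(nplayers g)) (y : profile g) (x : X) (lam : 'cV[R]_d).

Lemma deviate_at y i (a : 'I_(top i).+1) : deviate y a i = a.
Proof. by rewrite ffunE eqtype.dfwith_in. Qed.

Lemma deviate_id y i : deviate y (y i) = y.
Proof.
apply/ffunP => j; rewrite ffunE; have [<-|ij] := eqVneq i j.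
  by rewrite eqtype.dfwith_in.
by rewrite eqtype.dfwith_out.
Qed.

(** The real-valued threshold, meaningful for [0 < l <= top i]; it serves as the [c] of the
    single-peakedness lemma. *)
Definition cutoff i (l : nat) y x lam : R :=
  let lo : 'I_(top i).+1 := inord l.-1 in
  let hi : 'I_(top i).+1 := inord l in
  (V gam sig i (deviate y lo) x lam - V gam sig i (deviate y hi) x lam) /
  (act hi - act lo).

Lemma thresholdE i l y x lam : (0 < l)%N -> (l <= top i)%N ->
  threshold gam sig i l y x lam = (cutoff i l y x lam)%:E.
Proof. by case: l => // l _ /= ->. Qed.

Lemma threshold0 i y x lam : threshold gam sig i 0 y x lam = -oo%E.
Proof. by []. Qed.

Lemma threshold_top i y x lam : threshold gam sig i (top i).+1 y x lam = +oo%E.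
Proof. by rewrite /= ltnn. Qed.

Lemma act_inord_lt i l : (l < top i)%N ->
  act (inord l : 'I_(top i).+1) < act (inord l.+1 : 'I_(top i).+1).
Proof. by move=> lt; apply: act_increasing; rewrite !inordK// ltnW. Qed.

Lemma utility_step i l y x lam e : (l < top i)%N ->
  u gam sig i (deviate y (inord l.+1 : 'I_(top i).+1)) x lam e -
  u gam sig i (deviate y (inord l : 'I_(top i).+1)) x lam e =
  (act (inord l.+1 : 'I_(top i).+1) - act (inord l : 'I_(top i).+1)) *
  (e - cutoff i l.+1 y x lam).
Proof.
move=> lt; rewrite /u /cutoff/= !deviate_at.
have := act_inord_lt lt; set s := act _; set s' := act _ => ss.
by field; rewrite subr_eq0 gt_eqF.
Qed.

Variable Gamma : set 'cV[R]_k.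
Hypotheses (concave : strictly_concave_payoffs g Gamma) (Ggam : Gamma gam).

Lemma cutoff_increasing i l y x lam : (0 < l)%N -> (l < top i)%N ->
  cutoff i l y x lam < cutoff i l.+1 y x lam.
Proof.
move=> l0 lt; have := concave y x lam sig Ggam l0 lt.
rewrite /slope /cutoff/= prednK// -ltrN2 -!mulNr !opprB.
by case: l l0 lt.
Qed.

(** Utility along own actions is single-peaked with the cutoffs as switching points. At the lowest
    and highest action the infinite thresholds make the corresponding condition vacuous. *)
Lemma best_responseP i y x lam e :
  best_response gam sig i y x lam e <->
  (threshold gam sig i (y i) y x lam <= e%:E)%E /\
  (e%:E <= threshold gam sig i (y i).+1 y x lam)%E.
Proof.
pose U l := u gam sig i (deviate y (inord l : 'I_(top i).+1)) x lam e.
have Uy : U (y i) = u gam sig i y x lam e by rewrite /U inord_val deviate_id.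
have step l : (l < top i)%N ->
      0 < act (inord l.+1 : 'I_(top i).+1) - act (inord l : 'I_(top i).+1).
  by move=> lt; rewrite subr_gt0; exact: act_inord_lt.
have yt : (y i <= top i)%N by rewrite -ltnS.
have peak := @argmax_single_peaked R (top i) (y i) U
  (fun l => cutoff i l y x lam) e yt.
apply: (iff_trans (B := forall a, (a <= top i)%N -> U a <= U (y i))).
  split=> br a; last by have := br a; rewrite -ltnS ltn_ord Uy /U inord_val; exact.
  by move=> _; rewrite Uy; exact: br.
apply: (iff_trans (peak _ _ _)).
- by move=> l lt; rewrite -subr_ge0 utility_step// pmulr_rge0 ?step// subr_ge0.
- by move=> l lt; rewrite -subr_le0 utility_step// pmulr_rle0 ?step// subr_le0.
- by move=> l; exact: cutoff_increasing.
have lowE : (threshold gam sig i (y i) y x lam <= e%:E)%E <->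
    ((0 < y i)%N -> cutoff i (y i) y x lam <= e).
  have [->|y0] := posnP (y i); first by rewrite threshold0 leNye.
  by rewrite thresholdE// lee_fin; split=> [//|]; exact.
have highE : (e%:E <= threshold gam sig i (y i).+1 y x lam)%E <->
    ((y i < top i)%N -> e <= cutoff i (y i).+1 y x lam).
  have [yt'|ty] := ltnP (y i) (top i).
    by rewrite thresholdE// lee_fin; split=> [//|]; exact.
  have -> : nat_of_ord (y i) = top i by apply/eqP; rewrite eqn_leq yt ty.
  by rewrite threshold_top leey.
by rewrite lowE highE.
Qed.

Lemma threshold_le i y x lam :
  (threshold gam sig i (y i) y x lam <= threshold gam sig i (y i).+1 y x lam)%E.
Proof.
have yt : (y i <= top i)%N by rewrite -ltnS.
have [y0|y0] := posnP (y i); first by rewrite {1}y0 threshold0 leNye.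
have [yt'|ty] := ltnP (y i) (top i).
  by rewrite !thresholdE// lee_fin ltW// cutoff_increasing.
have -> : (nat_of_ord (y i)).+1 = (top i).+1 by congr S; apply/eqP; rewrite eqn_leq yt ty.
by rewrite threshold_top leey.
Qed.

End best_response.

(** Interpolation without arithmetic on infinities: thresholds with the same index are all finite or
    all the same infinity, whatever the parameter and the common shock. *)
Definition ereal_interp (R : realType) (t : R) (a b c : \bar R) : Prop :=
  match a, b, c with
  | -oo%E, -oo%E, -oo%E => True
  | +oo%E, +oo%E, +oo%E => True
  | a%:E, b%:E, c%:E => c = (1 - t) * a + t * b
  | _, _, _ => False
  end.

Section logistic_ext.
Context {R : realType}.
Implicit Types a b : \bar R.

Lemma logistic_extB_ge0 a b : (a <= b)%E -> 0 <= logistic_ext b - logistic_ext a.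
Proof.
case: a => [a| |]; case: b => [b| |] //= ab; rewrite ?subrr ?subr0//.
- exact: logisticB_ge0.
- by rewrite subr_ge0 logistic_le1.
- exact: logistic_ge0.
Qed.

(** An infinite endpoint turns the increment into a logistic value, the constant 1 or the constant
    0; the upper tail becomes a logistic value by reflection. *)
Lemma logistic_extB_interp (t : R) a b a' b' a'' b'' : 0 < t -> t < 1 ->
  (a <= b)%E -> (a' <= b')%E ->
  ereal_interp t a a' a'' -> ereal_interp t b b' b'' ->
  (logistic_ext b - logistic_ext a) `^ (1 - t) *
  (logistic_ext b' - logistic_ext a') `^ t <= logistic_ext b'' - logistic_ext a''.
Proof.
move=> t0 t1; have t1' : 1 - t != 0 by lra.
have opp (z z' : R) : - ((1 - t) * z + t * z') = (1 - t) * - z + t * - z' by ring.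
case: a a' a'' => [a| |] [a'| |] [a''| |]//; case: b b' b'' => [b| |] [b'| |] [b''| |]//=;
  rewrite ?lee_fin ?leeNy_eq ?leye_eq// => ab ab' Ha Hb; rewrite ?Ha ?Hb ?subrr ?subr0.
- exact: logisticB_interp.
- by rewrite !logisticN opp logistic_interp.
- by rewrite powR0// mul0r.
- exact: logistic_interp.
- by rewrite !powR1 mulr1.
- by rewrite powR0// mul0r.
Qed.

End logistic_ext.

Section cutoff_interp.
Context {R : realType} {X Sigma : Type} {k d : nat}.
Variables (g : ordered_game R X Sigma k d) (Gamma : set 'cV[R]_k) (sig : Sigma).
Hypothesis affine_v : forall i y x, affine_on Gamma (base_payoff (o := g) i y x).
Variables (t : R) (a b : 'cV[R]_k) (v w : 'cV[R]_d).
Hypotheses (Ga : Gamma a) (Gb : Gamma b) (Gab : Gamma ((1 - t) *: a + t *: b)).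

(** The base payoff is affine in the parameter and the loading term linear in the common shock, with
    [sig] the same at all three points. Joint affinity would fail if [sig] varied too. *)
Lemma V_interp i y x :
  V (g := g) ((1 - t) *: a + t *: b) sig i y x ((1 - t) *: v + t *: w) =
  (1 - t) * V a sig i y x v + t * V b sig i y x w.
Proof.
have [c [r cr]] := affine_v i y x.
rewrite /V !cr// !mulmxDr -!scalemxAr !mxE; ring.
Qed.

Lemma threshold_interp i l y x : (l <= (top i).+1)%N ->
  ereal_interp t (threshold (g := g) a sig i l y x v)
    (threshold b sig i l y x w)
    (threshold ((1 - t) *: a + t *: b) sig i l y x ((1 - t) *: v + t *: w)).
Proof.
case: l => [|l] //; rewrite /=; case: ifPn => // lt _ /=.
rewrite !V_interp; ring.
Qed.

End cutoff_interp.

Section geometric_mean_le_fin.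
Context {R : realType}.
Implicit Types t a b c : R.

Lemma geometric_mean_leP t a b c : 0 < t -> t < 1 -> 0 <= a -> 0 <= b -> 0 <= c ->
  geometric_mean_le t a%:E b%:E c%:E <-> a `^ (1 - t) * b `^ t <= c.
Proof.
move=> t0 t1 a0 b0 c0; split=> [H|abc p q p0 q0]; last first.
  rewrite !lte_fin lee_fin => pa qb; apply: le_trans abc.
  have s0 : 0 <= 1 - t by lra.
  apply: ler_pM; rewrite ?powR_ge0//.
    by apply: ge0_ler_powR; rewrite ?nnegrE// ltW.
  by apply: ge0_ler_powR; rewrite ?nnegrE// ltW.
have [->|aN0] := eqVneq a 0; first by rewrite powR0 ?mul0r//; lra.
have [->|bN0] := eqVneq b 0; first by rewrite (@powR0 _ t) ?mulr0//; lra.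
have {}a0 : 0 < a by rewrite lt0r aN0.
have {}b0 : 0 < b by rewrite lt0r bN0.
rewrite leNgt; apply/negP; set x := a `^ _ * b `^ _ => cx.
have x0 : 0 < x by rewrite mulr_gt0 ?powR_gt0.
(* [s * x] is the midpoint of [c] and [x]. Shrinking both [a] and [b] by [s] shrinks the geometric
   mean by exactly [s], as the exponents sum to 1. *)
have [s [s0 s1 cs]] : exists s, [/\ 0 < s, s < 1 & c < s * x].
  exists ((c + x) / (2 * x)); split; first by rewrite divr_gt0; lra.
    by rewrite ltr_pdivrMr; lra.
  have -> : (c + x) / (2 * x) * x = (c + x) / 2 by field; lra.
  lra.
have sa : ((s * a)%:E < a%:E)%E by rewrite lte_fin gtr_pMl.
have sb : ((s * b)%:E < b%:E)%E by rewrite lte_fin gtr_pMl.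
have := H _ _ (mulr_gt0 s0 a0) (mulr_gt0 s0 b0) sa sb.
rewrite !powRM ?(ltW s0) ?(ltW a0) ?(ltW b0)// mulrACA -powRD ?subrK ?oner_eq0//.
by rewrite powRr1 ?(ltW s0)// lee_fin -/x leNgt cs.
Qed.

End geometric_mean_le_fin.

(** * The law of a single logistic shock *)

Lemma logistic_left_cvg (R : realType) (a : R) : logistic x @[x --> a^'-] --> logistic a.
Proof.
apply: cvg_at_left_filter; rewrite /logistic.
apply: cvgM; first exact: cvg_cst.
apply: cvgV; first by rewrite gt_eqF// addr_gt0// expR_gt0.
apply: cvgD; first exact: cvg_cst.
apply: (@continuous_cvg _ _ _ _ _ _ (@expR R)); first exact: continuous_expR.
by apply: cvgN; exact: cvg_id.
Qed.

Section logistic_shock.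
Context {R : realType} {dT : measure_display} {T : measurableType dT}.
Variables (P : probability T R) (e : {RV P >-> R}).
Hypothesis cdf_e : forall t, cdf e t = (logistic t)%:E.

Lemma measurable_shock_le (b : \bar R) : measurable [set s : R | (s%:E <= b)%E].
Proof. by rewrite -[X in measurable X]setTI; apply: measurable_lee. Qed.

Lemma measurable_shock_lt (b : \bar R) : measurable [set s : R | (s%:E < b)%E].
Proof. by rewrite -[X in measurable X]setTI; apply: measurable_lte. Qed.

Lemma measurable_shock_between (a b : \bar R) :
  measurable [set s : R | (a <= s%:E)%E /\ (s%:E <= b)%E].
Proof.
rewrite (_ : [set _ | _] = [set s : R | (s%:E <= b)%E] `\` [set s : R | (s%:E < a)%E]).
  by apply: measurableD; [exact: measurable_shock_le|exact: measurable_shock_lt].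
by apply/seteqP; split=> s /=; [move=> [as_ sb]; split=> //; apply/negP; rewrite -leNgt
  |move=> [sb /negP]; rewrite -leNgt].
Qed.

Lemma measurable_preimage_shock (A : set R) : measurable A -> measurable (e @^-1` A).
Proof. by move=> mA; rewrite -[X in measurable X]setTI; exact: measurable_funPT. Qed.

Lemma prob_shock_le (b : \bar R) : P (e @^-1` [set s : R | (s%:E <= b)%E]) = (logistic_ext b)%:E.
Proof.
case: b => [b| |] /=.
- by rewrite -cdf_e /cdf/= /distribution/= /pushforward; congr (P _); apply/seteqP; split=> s; rewrite /= lee_fin in_itv.
- by rewrite (_ : _ @^-1` _ = setT) ?probability_setT//; apply/seteqP; split=> // s _ /=; rewrite leey.
- by rewrite (_ : _ @^-1` _ = set0) ?measure0//; apply/seteqP; split=> // s /=; rewrite leeNy_eq.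
Qed.

(** The law has no atoms: the probability is at least [logistic b] for every [b < a], and these
    values tend to [logistic a]. Ties at a threshold therefore carry no probability. *)
Lemma prob_shock_lt (a : \bar R) : P (e @^-1` [set s : R | (s%:E < a)%E]) = (logistic_ext a)%:E.
Proof.
case: a => [a| |] /=; last 2 first.
- by rewrite (_ : _ @^-1` _ = setT) ?probability_setT//; apply/seteqP; split=> // s _ /=; rewrite ltry.
- by rewrite (_ : _ @^-1` _ = set0) ?measure0//; apply/seteqP; split=> // s.
have mlt := measurable_preimage_shock (measurable_shock_lt a%:E).
have mle (b : R) := measurable_preimage_shock (measurable_shock_le b%:E).
apply/eqP; rewrite eq_le; apply/andP; split.
  rewrite -[(logistic a)%:E]/(logistic_ext a%:E)%:E -prob_shock_le.
  by apply: le_measure; rewrite ?inE// => s /= /ltW.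
rewrite -[leRHS]fineK ?fin_num_measure// lee_fin.
apply: (cvgr_to_le (logistic_left_cvg (a := a))).
near=> b; rewrite -lee_fin fineK ?fin_num_measure//.
rewrite -[(logistic b)%:E]/(logistic_ext b%:E)%:E -prob_shock_le.
apply: le_measure; rewrite ?inE// => s /= /le_lt_trans; apply.
by rewrite lte_fin; near: b; exact: nbhs_left_lt.
Unshelve. all: by end_near. Qed.

Lemma prob_shock_between (a b : \bar R) : (a <= b)%E ->
  P (e @^-1` [set s : R | (a <= s%:E)%E /\ (s%:E <= b)%E]) =
  (logistic_ext b - logistic_ext a)%:E.
Proof.
move=> ab.
have -> : e @^-1` [set s : R | (a <= s%:E)%E /\ (s%:E <= b)%E] =
    e @^-1` [set s : R | (s%:E <= b)%E] `\` e @^-1` [set s : R | (s%:E < a)%E].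
  by apply/seteqP; split=> s /=; [move=> [as_ sb]; split=> //; apply/negP; rewrite -leNgt
    |move=> [sb /negP]; rewrite -leNgt].
have mle := measurable_preimage_shock (measurable_shock_le b).
have mlt := measurable_preimage_shock (measurable_shock_lt a).
rewrite measureD//; last by rewrite ltey_eq fin_num_measure.
rewrite setIidr; first by rewrite EFinB -prob_shock_le -prob_shock_lt.
by move=> s /= sa; exact: (ltW (lt_le_trans sa ab)).
Qed.

End logistic_shock.

(** * Likelihoods *)

Section joint_law.
Context {R : realType} {dT : measure_display} {T : measurableType dT}.
Variable P : probability T R.

(** Independence says that the joint law agrees with the product measure on rectangles, hence on
    every measurable set. *)
Lemma prob_independent_pair d1 d2 (T1 : measurableType d1) (T2 : measurableType d2)
    (X : {RV P >-> T1}) (Y : {RV P >-> T2}) (S : set (T1 * T2)) :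
  independent_pair P (sigma_rv X) (sigma_rv Y) -> measurable S ->
  (P [set w | S (X w, Y w)] =
   \int[distribution P X]_x distribution P Y (xsection S x))%E.
Proof.
move=> XY mS.
have mZ : measurable_fun setT (fun w => (X w, Y w)).
  by apply/measurable_fun_pairP; split; exact: measurable_funPT.
apply/esym; apply: (@product_measure_unique _ _ _ _ _ (distribution P X)
  (distribution P Y) (pushforward_measure P mZ)) => // A B mA mB.
apply: XY; [exists A => //|exists B => //]; by rewrite setTI.
Qed.

(** The density hypothesis speaks of measures of sets only. Slicing in the other coordinate lets it
    act on each [ysection S y]; Tonelli then restores the original order with [h] inside. *)
Lemma integral_density_sections m d2 (T2 : measurableType d2)
    (X : {RV P >-> 'cV[R]_m}) (h : 'cV[R]_m -> R)
    (mu2 : {sigma_finite_measure set T2 -> \bar R}) (S : set ('cV[R]_m * T2)) :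
  has_lebesgue_density X h -> measurable S ->
  (\int[distribution P X]_v mu2 (xsection S v) =
   \int[@lebesgue_cV R m]_v (mu2 (xsection S v) * (h v)%:E))%E.
Proof.
move=> [mh h0 hX] mS; have [leb E] := lebesgue_cV_measure (R := R) m.
rewrite E in hX *.
rewrite integral_sections//.
pose f (z : 'cV[R]_m * T2) : \bar R := ((\1_S z)%:E * (h z.1)%:E)%E.
have mf : measurable_fun setT f.
  apply: emeasurable_funM; apply/measurable_EFinP; first exact: measurable_indic.
  exact: measurableT_comp.
have f0 z : (0 <= f z)%E by rewrite /f mule_ge0// lee_fin.
transitivity (\int[mu2]_y \int[leb]_v f (v, y))%E.
  apply: eq_integral => y _; apply: etrans (hX _ (measurable_ysection _ mS)) _.
  rewrite integral_mkcond; apply: eq_integral => v _.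
  rewrite /f patchE mem_ysection indicE; case: ifP => _; by rewrite ?mul1e ?mul0e.
rewrite -fubini_tonelli//; apply: eq_integral => v _.
rewrite /f/= ge0_integralZr//; last 2 first.
- by apply/measurable_EFinP; apply: measurableT_comp => //; exact: pair1_measurable.
- by rewrite lee_fin.
congr (_ * _)%E; transitivity (\int[mu2]_(y in xsection S v) cst 1%E y)%E.
  rewrite [RHS]integral_mkcond; apply: eq_integral => y _.
  by rewrite patchE mem_xsection indicE; case: ifP.
by rewrite integral_cst ?mul1e//; exact: measurable_xsection.
Qed.

Definition shock_vector n (eps : 'I_n -> {RV P >-> R}) (w : T) : 'cV[R]_n :=
  \col_i eps i w.

Lemma measurable_shock_vector n (eps : 'I_n -> {RV P >-> R}) :
  measurable_fun setT (shock_vector eps).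
Proof.
by apply: measurable_fun_cV => i; under eq_fun do rewrite mxE; exact: measurable_funPT.
Qed.

HB.instance Definition _ n (eps : 'I_n -> {RV P >-> R}) :=
  isMeasurableFun.Build _ _ _ _ (shock_vector eps) (measurable_shock_vector eps).

(** Transfers independence stated for the sigma-algebra generated by the family of shocks to events
    of the single vector that collects them. *)
Lemma sigma_shock_vector n (eps : 'I_n -> {RV P >-> R}) (B : set 'cV[R]_n) :
  measurable B -> <<s \bigcup_i sigma_rv (eps i) >> (shock_vector eps @^-1` B).
Proof.
move=> mB.
have : preimage_set_system setT (shock_vector eps)
    (g_sigma_preimage (fun i (v : 'cV[R]_n) => v i 0)) (shock_vector eps @^-1` B).
  by exists B => //; rewrite setTI.
rewrite -g_sigma_preimage_comp; apply: sub_sigma_algebra2 => A.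
rewrite -bigcup_seq => -[i _] A_i; exists i => //.
by move: A_i; congr (_ A); congr preimage_set_system; apply/funext => w; rewrite /= mxE.
Qed.

End joint_law.

Section nash_sections.
Context {R : realType} {X Sigma : Type} {k d : nat}.
Variables (g : ordered_game R X Sigma k d) (gam : 'cV[R]_k) (sig : Sigma).

Definition nash_region (y : profile g) (x : X) :
    set ('cV[R]_d * 'cV[R]_(nplayers g)) :=
  [set z : 'cV[R]_d * 'cV[R]_(nplayers g) |
    nash gam sig x z.1 (fun i => z.2 i 0) y].

Lemma measurable_loading (s : 'rV[R]_d) :
  measurable_fun setT (fun v : 'cV[R]_d => (s *m v) 0 0).
Proof.
under eq_fun do rewrite mxE; apply: measurable_sum => j.
by apply: measurable_funM => //; exact: measurable_cV_coord.
Qed.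

Lemma measurable_nash_region y x : measurable (nash_region y x).
Proof.
have mu_ i z : measurable_fun setT (fun w : 'cV[R]_d * 'cV[R]_(nplayers g) =>
    u gam sig i z x w.1 (w.2 i 0)).
  apply: measurable_funD; last first.
    apply: measurable_funM => //.
    exact: (measurableT_comp (measurable_cV_coord i)).
  apply: measurable_funD => //; apply: measurable_funM => //.
  exact: (measurableT_comp (measurable_loading _)).
rewrite (_ : nash_region y x = \bigcap_(i in [set: 'I_(nplayers g)])
    \bigcap_(a in [set: 'I_(top i).+1])
    [set z : 'cV[R]_d * 'cV[R]_(nplayers g) |
             ((u gam sig i (deviate y a) x z.1 (z.2 i 0))%:E <=
              (u gam sig i y x z.1 (z.2 i 0))%:E)%E]).
  apply: fin_bigcap_measurable => [|i _]; first exact: finite_finset.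
  apply: fin_bigcap_measurable => [|a _]; first exact: finite_finset.
  rewrite -[X in measurable X]setTI.
  by apply: measurable_lee => //; apply/measurable_EFinP.
apply/seteqP; split=> z /=.
  by move=> H i _ a _ /=; rewrite lee_fin; exact: H.
by move=> H i a; have := H i Logic.I a Logic.I; rewrite /= lee_fin.
Qed.

End nash_sections.

Section model.
Context {R : realType} {X Sigma : Type} {k d : nat}.
Variables (Gamma : set 'cV[R]_k) (g : ordered_game R X Sigma k d).
Context {dT : measure_display} {T : measurableType dT} (P : probability T R).
Variables (lam : {RV P >-> 'cV[R]_d}) (eps : 'I_(nplayers g) -> {RV P >-> R}).
Variables (h : 'cV[R]_d -> R).
Hypotheses (affine_v : forall i y x, affine_on Gamma (base_payoff (o := g) i y x))
  (lam_density : has_lebesgue_density lam h)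
  (h_log_concave : log_concave [set: 'cV[R]_d] h)
  (concave_own : strictly_concave_payoffs g Gamma)
  (eps_lam : independent_pair P (sigma_rv lam) (sigma_rv (shock_vector eps)))
  (eps_indep : mutually_independent P (fun i => sigma_rv (eps i)))
  (eps_logistic : forall i t, cdf (eps i) t = (logistic t)%:E).
Implicit Types (gam : 'cV[R]_k) (sig : Sigma) (y : profile g) (x : X)
  (l : 'cV[R]_d).

Definition logistic_bracket gam sig y x l i : R :=
  logistic_ext (threshold gam sig i (y i).+1 y x l) -
  logistic_ext (threshold gam sig i (y i) y x l).

Lemma logistic_bracket_ge0 gam sig y x l i :
  Gamma gam -> 0 <= logistic_bracket gam sig y x l i.
Proof. by move=> Gg; apply/logistic_extB_ge0/threshold_le; first exact: concave_own. Qed.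

Lemma best_response_event gam sig i y x l : Gamma gam ->
  [set w | best_response gam sig i y x l (eps i w)] = eps i @^-1` [set s : R |
    (threshold gam sig i (y i) y x l <= s%:E)%E /\
    (s%:E <= threshold gam sig i (y i).+1 y x l)%E].
Proof.
by move=> Gg; apply/seteqP; split=> w /=; rewrite (best_responseP _ concave_own Gg).
Qed.

Lemma prob_best_response gam sig i y x l : Gamma gam ->
  P [set w | best_response gam sig i y x l (eps i w)] =
  (logistic_bracket gam sig y x l i)%:E.
Proof.
move=> Gg; rewrite best_response_event// prob_shock_between//.
exact: (threshold_le _ concave_own Gg).
Qed.

Lemma prob_nash gam sig y x l : Gamma gam ->
  P [set w | nash gam sig x l (eps ^~ w) y] =
  (\prod_i logistic_bracket gam sig y x l i)%:E.
Proof.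
move=> Gg; pose A i := [set w | best_response gam sig i y x l (eps i w)].
rewrite (_ : [set w | _] =
    \bigcap_(i in [set` [set: 'I_(nplayers g)]%SET]) A i); last first.
  apply/seteqP; split=> w /= H i; first by move=> _; exact: H.
  by apply: H; rewrite /= inE.
rewrite eps_indep => [|i _].
  rewrite -prodEFin; apply: eq_big => [i|i _]; first by rewrite inE.
  exact: prob_best_response.
rewrite /A best_response_event//; eexists; last by rewrite setTI.
exact: measurable_shock_between.
Qed.

Lemma shock_vectorE w : (fun i => shock_vector eps w i 0) = eps ^~ w.
Proof. by apply/funext => i; rewrite mxE. Qed.

Lemma shock_vector_section gam sig y x l : Gamma gam ->
  distribution P (shock_vector eps) (xsection (nash_region gam sig y x) l) =
  (\prod_i logistic_bracket gam sig y x l i)%:E.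
Proof.
move=> Gg; rewrite -prob_nash//; congr (P _).
by apply/seteqP; split=> w; rewrite /xsection/= inE /nash_region/= shock_vectorE.
Qed.

Lemma likelihoodE gam sig y x : Gamma gam ->
  (likelihood gam sig lam eps y x)%:E =
  (\int[@lebesgue_cV R d]_l
    (\prod_i logistic_bracket gam sig y x l i * h l)%:E)%E.
Proof.
move=> Gg; have mS := measurable_nash_region gam sig y x.
have E : [set w | nash gam sig x (lam w) (eps ^~ w) y] =
    [set w | nash_region gam sig y x (lam w, shock_vector eps w)].
  by apply/seteqP; split=> w; rewrite /nash_region/= shock_vectorE.
rewrite /likelihood E fineK; last first.
  apply: fin_num_measure; rewrite -[X in measurable X]setTI.
  have mZ : measurable_fun setT (fun w => (lam w, shock_vector eps w)).
    by apply/measurable_fun_pairP; split; exact: measurable_funPT.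
  exact: mZ.
rewrite (prob_independent_pair eps_lam mS) (integral_density_sections _ lam_density mS).
have [leb ->] := lebesgue_cV_measure (R := R) d.
apply: eq_integral => l _; rewrite EFinM; congr (_ * _)%E.
exact: shock_vector_section.
Qed.

Lemma logistic_bracket_interp t a b sig y x v w i : 0 < t -> t < 1 ->
  Gamma a -> Gamma b -> Gamma ((1 - t) *: a + t *: b) ->
  logistic_bracket a sig y x v i `^ (1 - t) * logistic_bracket b sig y x w i `^ t <=
  logistic_bracket ((1 - t) *: a + t *: b) sig y x ((1 - t) *: v + t *: w) i.
Proof.
move=> t0 t1 Ga Gb Gab; apply: logistic_extB_interp => //.
- exact: (threshold_le _ concave_own Ga).
- exact: (threshold_le _ concave_own Gb).
- by apply: (threshold_interp _ affine_v) => //; exact: ltnW.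
- exact: (threshold_interp _ affine_v).
Qed.

Lemma likelihood_log_concave sig y x :
  log_concave Gamma (fun gam => likelihood gam sig lam eps y x).
Proof.
split=> [gam _|t a b t0 t1 Ga Gb Gab]; first exact/fine_ge0.
have [mh h0 _] := lam_density.
pose Q gam l := \prod_i logistic_bracket gam sig y x l i.
have Q0 gam l : Gamma gam -> 0 <= Q gam l.
  by move=> Gg; apply: prodr_ge0 => i _; exact: logistic_bracket_ge0.
have Qh0 gam l : Gamma gam -> 0 <= Q gam l * h l by move=> Gg; rewrite mulr_ge0// Q0.
have mQ gam : Gamma gam -> measurable_fun setT (fun l => (Q gam l * h l)%:E).
  (* The product of brackets is the measure of a section of the measurable equilibrium region, which
     gives its measurability in the common shock. *)
  move=> Gg; rewrite (_ : (fun _ => _) = (fun l =>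
    distribution P (shock_vector eps) (xsection (nash_region gam sig y x) l) *
    (h l)%:E)%E); last by apply/funext => l; rewrite shock_vector_section// EFinM.
  apply: emeasurable_funM; last exact/measurable_EFinP.
  exact: measurable_fun_xsection (measurable_nash_region _ _ _ _).
have L0 gam : 0 <= likelihood gam sig lam eps y x by exact/fine_ge0.
apply/geometric_mean_leP => //; rewrite !likelihoodE//.
apply: prekopa_leindler => //; try exact: mQ; try by move=> l; rewrite lee_fin Qh0.
move=> v w; apply/geometric_mean_leP; rewrite ?Qh0//.
apply: powR_interpM; rewrite ?Q0//.
  by apply: powR_interp_prod => i; [exact: logistic_bracket_ge0..|exact: logistic_bracket_interp].
by apply: h_log_concave.2.
Qed.

Lemma identified_slice_convex (phi : X -> profile g -> R) sig : is_ccp phi ->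
  @convex_set R 'cV[R]_k Gamma ->
  @convex_set R 'cV[R]_k (identified_slice lam eps phi Gamma sig).
Proof.
move=> ccp cG; apply/convex_setW => a b /set_mem[Ga La] /set_mem[Gb Lb] s s0 s1.
have Gab : Gamma (s%:num *: (a : 'cV[R]_k) + (1 - s%:num) *: (b : 'cV[R]_k)).
  by apply/set_mem; apply: (cG a b s); exact: mem_set.
apply/mem_set; split=> // y x.
have [_ lc] := likelihood_log_concave sig y x.
(* The convex combination puts weight [s] on [a], whereas [log_concave] puts weight [t] on its
   second point; hence [t = 1 - s]. *)
have := lc (1 - s%:num) a b.
rewrite subKr; have phi0 := (ccp x).1 y.
(* Writing [phi] as the geometric mean of itself with itself, each factor is dominated by a power of
   a likelihood; [0 <= phi] makes the powers monotone. *)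
move=> H; apply: (@le_trans _ _ (phi x y `^ s%:num * phi x y `^ (1 - s%:num))).
  have [->|pN0] := eqVneq (phi x y) 0; first by rewrite mulr_ge0 ?powR_ge0.
  by rewrite -powRD ?subrKC ?oner_eq0// powRr1.
apply: le_trans (H _ _ Ga Gb Gab); last 2 first.
- by rewrite subr_gt0.
- by rewrite ltrBlDr ltrDl.
apply: ler_pM; rewrite ?powR_ge0//.
  by apply: ge0_ler_powR; rewrite ?nnegrE ?La// ?(le_trans phi0)// ltW.
by apply: ge0_ler_powR; rewrite ?nnegrE ?subr_ge0 ?Lb// ?(le_trans phi0)// ltW.
Qed.

End model.

Theorem theorem4 (R : realType) (k d : nat)
  (dX : measure_display) (X : measurableType dX)
  (discreteX : forall B : set X, measurable B)
  (Sigma : Type) (Gamma : set 'cV[R]_k)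
  (g : ordered_game R X Sigma k d)
  (affine_v : forall i y x, affine_on Gamma (base_payoff (o := g) i y x))
  (dT : measure_display) (T : measurableType dT) (P : probability T R)
  (xi : {RV P >-> X}) (lam : {RV P >-> 'cV[R]_d})
  (eps : 'I_(nplayers g) -> {RV P >-> R})
  (h : 'cV[R]_d -> R)
  (shocks_indep : mutually_independent P (shock_sigma lam eps))
  (shocks_indep_x : independent_pair P (sigma_rv xi) 
     <<s \bigcup_j shock_sigma lam eps j >>)
  (lam_density : has_lebesgue_density lam h)
  (h_log_concave : log_concave [set: 'cV[R]_d] h)
  (concave_own : strictly_concave_payoffs g Gamma)
  (eps_indep_x_lam : independent_pair P <<s \bigcup_i sigma_rv (eps i) >>
     <<s sigma_rv xi `|` sigma_rv lam >>)
  (eps_indep : mutually_independent P (fun i => sigma_rv (eps i)))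
  (eps_logistic : forall i t, cdf (eps i) t = (logistic t)%:E)
  (phi : X -> profile g -> R) (phi_ccp : is_ccp phi) :
  [/\ forall i y x l gam sig, Gamma gam ->
        br_prob gam sig eps i y x l =
        logistic_ext (threshold gam sig i (y i).+1 y x l) -
        logistic_ext (threshold gam sig i (y i) y x l),
      forall y x l gam sig, Gamma gam ->
        cond_likelihood gam sig eps y x l =
        \prod_i (logistic_ext (threshold gam sig i (y i).+1 y x l) -
                 logistic_ext (threshold gam sig i (y i) y x l)),
      forall y x gam sig, Gamma gam ->
        (likelihood gam sig lam eps y x)%:E =
        (\int[@lebesgue_cV R d]_l
          (\prod_i (logistic_ext (threshold gam sig i (y i).+1 y x l) -
                    logistic_ext (threshold gam sig i (y i) y x l))
           * h l)%:E)%E,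
      forall sig y x, log_concave Gamma
        (fun gam => likelihood gam sig lam eps y x) &
      @convex_set R 'cV[R]_k Gamma -> forall sig,
        @convex_set R 'cV[R]_k
          (identified_slice lam eps phi Gamma sig)].
Proof.
(* Independence of the shocks from the pair of covariate and common shock, restricted to events of
   the common shock alone. *)
have eps_lam : independent_pair P (sigma_rv lam) (sigma_rv (shock_vector eps)).
  move=> _ _ [A mA <-] [B mB <-]; rewrite setIC muleC; apply: eps_indep_x_lam.
    by rewrite setTI; exact: sigma_shock_vector.
  by apply: sub_gen_smallest; right; exists A.
split.
- move=> i y x l gam sig Gg.
  by rewrite /br_prob (prob_best_response concave_own eps_logistic).
- move=> y x l gam sig Gg.
  by rewrite /cond_likelihood (prob_nash concave_own eps_indep eps_logistic).
- move=> y x gam sig Gg.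
  exact: (likelihoodE lam_density concave_own eps_lam eps_indep eps_logistic).
- move=> sig y x.
  exact: (likelihood_log_concave affine_v lam_density h_log_concave concave_own
    eps_lam eps_indep eps_logistic).
- move=> cG sig; exact: (identified_slice_convex affine_v lam_density
    h_log_concave concave_own eps_lam eps_indep eps_logistic).
Qed.
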